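(* (1) $\operatorname{non}(M_{\mathrm{Fin}\otimes\mathrm{Fin}})=\mathfrak e^{\mathrm{const}}_{\le}(2)$ and $\operatorname{cov}(M_{\mathrm{Fin}\otimes\mathrm{Fin}})=\mathfrak v^{\mathrm{const}}_{\le}(2)$. On the other hand, $\operatorname{non}(K_{\mathrm{Fin}\otimes\mathrm{Fin}})=\mathfrak b$ and $\operatorname{cov}(K_{\mathrm{Fin}\otimes\mathrm{Fin}})=\mathfrak d$. (2) $\operatorname{non}(M_{\mathcal S})=\operatorname{non}(K_{\mathcal S})=\max\{\mathfrak b,\operatorname{cov}_\omega(\mathcal N)\}$ and $\operatorname{cov}(M_{\mathcal S})=\operatorname{cov}(K_{\mathcal S})=\min\{\mathfrak d,\operatorname{non}(\mathcal N)\}$. (3) $\operatorname{non}(M_{\mathcal Z})=\max\{\mathfrak b,\operatorname{non}(\mathcal E)\}$ and $\operatorname{cov}(M_{\mathcal Z})=\min\{\mathfrak d,\operatorname{cov}(\mathcal E)\}$.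
   Context: For an ideal $\mathscr I$ on a countable set $X$ (proper, containing all finite sets): $M_{\mathscr I}$ is the $\sigma$-ideal on $X^\omega$ generated by the sets $M_\phi=\{x\in X^\omega:\forall^\infty n\ x(n)\in\phi(x\upharpoonright n)\}$, $\phi\colon X^{<\omega}\to\mathscr I$; $K_{\mathscr I}$ is the $\sigma$-ideal on $X^\omega$ generated by the sets $K_\phi=\{x\in X^\omega:\forall^\infty n\ x(n)\in\phi(n)\}$, $\phi\colon\omega\to\mathscr I$. For a $\sigma$-ideal $\mathcal I$ on $Y$, $\operatorname{non}(\mathcal I)$ is the least size of a subset of $Y$ not in $\mathcal I$ and $\operatorname{cov}(\mathcal I)$ is the least size of a subfamily of $\mathcal I$ covering $Y$. $\mathfrak b,\mathfrak d$ are the bounding and dominating numbers. Ideals on countable sets: $\mathrm{Fin}\otimes\mathrm{Fin}$ is the ideal on $\omega\times\omega$ of all $A$ such that for all but finitely many $n$ the section $(A)_n=\{m:\langle n,m\rangle\in A\}$ is finite. $\mathcal S$ (Solecki ideal) is the ideal on $\Omega=\{U\subseteq2^\omega: U\text{ clopen of Lebesgue measure }1/2\}$ generated by the subsets $A\subseteq\Omega$ with $\bigcap A\ne\emptyset$. $\mathcal Z=\{A\subseteq\omega:\lim_{n\to\infty}|A\cap n|/n=0\}$. $\sigma$-ideals: $\mathcal N$ is the Lebesgue null ideal; $\mathcal E$ is the $\sigma$-ideal on $2^\omega$ generated by closed null sets. $\operatorname{cov}_\omega(\mathcal N)=\min\{|\mathcal A|:\mathcal A\subseteq\mathcal N,\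 \forall B\in[\mathbb R]^\omega\,\exists A\in\mathcal A\ B\subseteq A\}$, where $[\mathbb R]^\omega$ is the set of countably infinite sets of reals. A predictor is a function $\pi\colon\omega^{<\omega}\to\omega$; $\mathrm{Pred}$ is the set of predictors. For $f\in\omega^\omega$ and $\pi\in\mathrm{Pred}$ write $f\sqsubset^{\mathrm{pc},2}_{\le}\pi$ iff for all but finitely many $i<\omega$ there is $j\in[i,i+2)$ with $f(j)\le\pi(f\upharpoonright j)$. Then $\mathfrak e^{\mathrm{const}}_{\le}(2)=\min\{|F|:F\subseteq\omega^\omega,\ \forall\pi\in\mathrm{Pred}\,\exists f\in F\ \neg(f\sqsubset^{\mathrm{pc},2}_{\le}\pi)\}$ and $\mathfrak v^{\mathrm{const}}_{\le}(2)=\min\{|\Pi|:\Pi\subseteq\mathrm{Pred},\ \forall f\in\omega^\omega\,\exists\pi\in\Pi\ f\sqsubset^{\mathrm{pc},2}_{\le}\pi\}$. *)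

(* Defs.v *)
From HB Require Import structures.
From mathcomp Require Import all_boot all_order all_algebra.
From mathcomp Require Import all_classical all_reals all_analysis.

Set Implicit Arguments.
Unset Strict Implicit.
Unset Printing Implicit Defensive.

Import Order.TTheory GRing.Theory Num.Theory.
Import numFieldNormedType.Exports.

Local Open Scope classical_set_scope.
Local Open Scope card_scope.
Local Open Scope ring_scope.

(* A cardinal is represented by any set of that size, so that equality of
cardinals is equipotence [#=] and their order is [#<=]. *)

(* The cardinal min {|A| : A \in F}, represented by a member of [F] of least
   size; such a member exists as soon as [F] is nonempty ([card_minP]). The
   default [set0] is only reached when [F] is empty. *)
Definition card_min (T : Type) (F : set (set T)) : set T :=
  xget set0 [set A | F A /\ forall B, F B -> A #<= B].

Definition maxc (T U : Type) (A : set T) (B : set U) : set (T + U) :=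
  if A #<= B then inr @` B else inl @` A.

Definition minc (T U : Type) (A : set T) (B : set U) : set (T + U) :=
  if A #<= B then inl @` A else inr @` B.

Lemma card_minP (T : Type) (F : set (set T)) : F !=set0 ->
  F (card_min F) /\ forall B, F B -> card_min F #<= B.
Proof.
move=> [A0 FA0].
pose P : set (set (set_type F -> T)) := [set S |
  (forall s i, S s -> set_val i (s i)) /\
  (forall i s t, S s -> S t -> s i = t i -> s = t)].
have [G GP Gtot|S [[SA Sinj] Smax]] := @Zorn_bigcup _ P.
  split=> [s i [X GX Xs]|i s t [X GX Xs] [Y GY Yt]].
    by have [+ _] := GP _ GX; apply.
  have [XY|YX] := Gtot _ _ GX GY.
    by have [_] := GP _ GY; apply => //; exact: XY.
  by have [_] := GP _ GX; apply => //; exact: YX.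
suff [i iS] : exists i : set_type F, set_val i `<=` [set s i | s in S].
  apply: (@xgetPex _ set0 [set A | F A /\ forall B, F B -> A #<= B]).
  exists (set_val i); split; first exact: set_valP.
  move=> B FB.
  pose j : set_type F := exist _ B (mem_set FB).
  apply: card_le_trans (subset_card_le iS) _.
  apply: card_le_trans (card_image_le _ _) _.
  have Sj : [set s j | s in S] #= S.
    by apply: inj_card_eq => s t /set_mem Ss /set_mem St; exact: Sinj.
  rewrite -(card_le_eql Sj); apply: subset_card_le => _ [s Ss <-].
  exact: (SA s j Ss).
apply: contrapT => /forallNP noi.
have /choice[t tP] : forall i : set_type F,
    exists x, set_val i x /\ ~ [set s i | s in S] x.
  by move=> i; have /existsNP[x /not_implyP] := noi i; exists x.
apply: (Smax (S `|` [set t])).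
  split; first exact: subsetUl.
  move=> /(_ t (or_intror erefl)) St.
  by have [_] := tP (exist _ A0 (mem_set FA0)); apply; exists t.
split=> [s i [Ss|->]|i s u [Ss|->] [Su|->]] //.
- exact: SA.
- by have [] := tP i.
- exact: Sinj.
- by move=> si; have [_ []] := tP i; exists s.
- by move=> si; have [_ []] := tP i; exists u.
Qed.

(* Properness and the finite sets are part of the definition of an ideal. This
   does not affect [smallest ideal G] when the family [G] is contained in some
   ideal, which is the case below. *)
Definition ideal (X : Type) (I : set (set X)) : Prop :=
  [/\ forall A, finite_set A -> I A,
      ~ I setT,
      forall A B, A `<=` B -> I B -> I A
    & forall A B, I A -> I B -> I (A `|` B)].

Definition sigma_ideal (Y : Type) (J : set (set Y)) : Prop :=
  [/\ J set0,
      forall A B, A `<=` B -> J B -> J A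
    & forall A : nat -> set Y, (forall n, J (A n)) -> J (\bigcup_n A n)].

Definition non (Y : Type) (J : set (set Y)) : set Y :=
  card_min [set A | ~ J A].

Definition cov (Y : Type) (J : set (set Y)) : set (set Y) :=
  card_min [set C | C `<=` J /\ \bigcup_(A in C) A = setT].

Section ideal_on_sequences.
Variables (X : Type) (I : set (set X)).

Definition M_gen (phi : seq X -> set X) : set (nat -> X) :=
  [set x | \forall n \near \oo, phi (mkseq x n) (x n)].

Definition M_ideal : set (set (nat -> X)) :=
  smallest (@sigma_ideal (nat -> X))
    [set M_gen phi | phi in [set phi | forall s, I (phi s)]].

Definition K_gen (phi : nat -> set X) : set (nat -> X) :=
  [set x | \forall n \near \oo, phi n (x n)].

Definition K_ideal : set (set (nat -> X)) :=
  smallest (@sigma_ideal (nat -> X))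
    [set K_gen phi | phi in [set phi | forall n, I (phi n)]].

End ideal_on_sequences.

Definition cylinder (s : seq bool) : set cantor_space :=
  [set x | mkseq x (size s) = s].

(* The outer measure of the fair coin-tossing measure: the infimum of the total
   weights of countable covers by basic clopen sets. It is defined on all
   subsets, and gives the Lebesgue measure of the measurable ones. *)
Definition cantor_measure (R : realType) (A : set cantor_space) : \bar R :=
  ereal_inf [set (\sum_(0 <= n <oo) ((2^-1 : R) ^+ size (s n))%:E)%E |
    s in [set s : nat -> seq bool | A `<=` \bigcup_n cylinder (s n)]].

Definition FinFin : set (set (nat * nat)) :=
  [set A | \forall n \near \oo, finite_set [set m | A (n, m)]].

Definition Omega (R : realType) : set (set cantor_space) :=
  [set U | clopen U /\ cantor_measure R U = (2^-1 : R)%:E].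

Definition Solecki (R : realType) : set (set (set_type (Omega R))) :=
  smallest (@ideal (set_type (Omega R)))
    [set A | (\bigcap_(U in A) set_val U) !=set0].
Arguments Solecki R : clear implicits.

Definition density_zero (R : realType) : set (set nat) :=
  [set A | (#|[pred k : 'I_n | (k : nat) \in A]|%:R / n%:R : R)
             @[n --> \oo] --> (0 : R)].

Definition null_ideal (R : realType) : set (set R) :=
  [set A | (@lebesgue_measure R).-negligible A].
Arguments null_ideal R : clear implicits.

Definition E_ideal (R : realType) : set (set cantor_space) :=
  smallest (@sigma_ideal cantor_space)
    [set A | closed A /\ cantor_measure R A = 0%E].

Definition cov_omega_null (R : realType) : set (set R) :=
  card_min [set C : set (set R) | C `<=` null_ideal R /\
    forall B : set R, B #= [set: nat] -> exists2 A, C A & B `<=` A].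
Arguments cov_omega_null R : clear implicits.

Definition le_star (f g : nat -> nat) : Prop :=
  \forall n \near \oo, (f n <= g n)%N.

Definition bounding : set (nat -> nat) :=
  card_min [set F | ~ exists g, forall f, F f -> le_star f g].

Definition dominating : set (nat -> nat) :=
  card_min [set F | forall f, exists2 g, F g & le_star f g].

Definition predictor : Type := seq nat -> nat.

Definition predicted_le (k : nat) (f : nat -> nat) (p : predictor) : Prop :=
  \forall i \near \oo, exists j : nat,
    (i <= j < i + k)%N /\ (f j <= p (mkseq f j))%N.

Definition e_const_le (k : nat) : set (nat -> nat) :=
  card_min [set F | forall p, exists2 f, F f & ~ predicted_le k f p].

Definition v_const_le (k : nat) : set predictor :=
  card_min [set P | forall f, exists2 p, P p & predicted_le k f p].

(* Main.v *)
(* Each invariant is the unbounding number [bnum] or the dominating number [dnum]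
   of a relation between "points" and "bounds", so the (in)equalities reduce to
   Tukey connections, together with a sequential composition: if a point coded by
   [x1] and [x2] is bounded by [y] only when [x1] is bounded by a bound computed
   from [y], or [x2] by a bound computed from [y] and [x1], then the unbounding
   number is at most the maximum, and the dominating number at least the minimum,
   of those of the two components (this uses [A * A #<= A] for infinite [A]).
   The key point for M-ideals is that a function eventually dominated by
   [g (f|n)] is dominated by a function depending on [g] only.
   - Fin x Fin: [x : nat -> nat * nat] is [f : nat -> nat] read two values at a
     time; applying this to [f] and to its shift covers all windows [i, i+2).
   - Solecki ideal: [U] is small when it is hit by a finite set of points. Random
     finite sets hit, by Borel-Cantelli, almost all members of a sequence in
     Omega; conversely a null set [A] lies in an open set of measure at most 1/2,
     whose clopen approximations avoid members of Omega.
   - Density zero: [k] in [2^l, 2^(l+1)) codes a binary word of length [l], so that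
     small subtrees of 2^<omega correspond to density zero sets. *)
Require Import Defs.
From mathcomp Require Import all_boot all_order all_algebra.
From mathcomp Require Import all_classical all_reals all_analysis.
From mathcomp Require Import lra zify.

Set Implicit Arguments.
Unset Strict Implicit.
Unset Printing Implicit Defensive.

Import Order.TTheory GRing.Theory Num.Theory.
Import numFieldNormedType.Exports.

Local Open Scope classical_set_scope.
Local Open Scope card_scope.

(** * Cardinal arithmetic *)

(** Injections are described by relations, so that the choice of values is made once, here. *)
Lemma card_le_rel (T U : Type) (A : set T) (B : set U) (r : T -> U -> Prop) :
  (forall a, A a -> exists2 b, B b & r a b) ->
  (forall a a' b, A a -> A a' -> r a b -> r a' b -> a = a') -> A #<= B.
Proof.
move=> tot inj.
have /choice[f fP] : forall a : set_type A,
    exists b : set_type B, r (set_val a) (set_val b).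
  move=> a; have [b Bb rab] := tot _ (set_valP a).
  by exists (exist _ b (mem_set Bb)).
apply/card_leP/injfunPex; exists f => // a a' _ _ faa'.
apply: val_inj => /=; apply: (inj _ _ (set_val (f a))).
- exact: set_valP.
- exact: set_valP.
- exact: fP.
- by rewrite faa'; exact: fP.
Qed.

Lemma card_le_fun (T U : Type) (A : set T) (B : set U) : B !=set0 ->
  A #<= B -> exists2 f : T -> U, set_fun A B f & set_inj A f.
Proof.
elim/Ppointed: U => U in B *; first by rewrite !emptyE => -[].
by move=> _ /pcard_leP/injfunPex.
Qed.

Lemma card_leX (T U T' U' : Type) (A : set T) (B : set U) (A' : set T')
    (B' : set U') : A #<= A' -> B #<= B' -> A `*` B #<= A' `*` B'.
Proof.
elim/Ppointed: T' => T' in A' *.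
  by rewrite !emptyE => ->; rewrite set0X.
elim/Ppointed: U' => U' in B' *.
  by rewrite !emptyE => _ ->; rewrite setX0.
move=> /pcard_leP/injfunPex[f fA fi] /pcard_leP/injfunPex[g gB gi].
apply: (@card_le_rel _ _ _ _ (fun p q => q = (f p.1, g p.2))).
  by move=> [a b] [/= /fA ? /gB ?]; exists (f a, g b).
move=> [a b] [a' b'] c [/= Aa Bb] [/= Aa' Bb'] -> [].
by move=> /fi <-; rewrite ?inE// => /gi <-; rewrite ?inE.
Qed.

(** Comparability comes from [card_minP]: both sets are copied into the sum type, and the family of
    the two copies has a member of least size. *)
Lemma card_le_total (T U : Type) (A : set T) (B : set U) :
  A #<= B \/ B #<= A.
Proof.
pose A' : set (T + U) := inl @` A; pose B' : set (T + U) := inr @` B.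
have eA : A' #= A by apply: inj_card_eq => ? ? _ _ [].
have eB : B' #= B by apply: inj_card_eq => ? ? _ _ [].
have [|mF mle] := @card_minP _ [set A'; B'].
  by exists A'; left.
rewrite -(card_le_eql eA) -(card_le_eqr eB) -(card_le_eql eB) -(card_le_eqr eA).
move: mle; case: mF => -> mle; [left|right]; apply: mle; [by right|by left].
Qed.

Section infinite_square.
Variables (T : Type) (A : set T).
Implicit Types G : set (T * T * T).

(* Zorn's lemma for the injections [B * B -> B] with [B] included in [A], each
   represented by its graph [G], [B] being read off the diagonal of [G]. *)
Let base G : set T := [set a | exists t, G (a, a, t)].

Let square_inj G := [/\ base G `<=` A,
  forall a b t, G (a, b, t) -> [/\ base G a, base G b & base G t],
  forall a b, base G a -> base G b -> exists t, G (a, b, t),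
  forall p t t', G (p, t) -> G (p, t') -> t = t'
  & forall p p' t, G (p, t) -> G (p', t) -> p = p'].

Let base_sub G G' : G `<=` G' -> base G `<=` base G'.
Proof. by move=> GG' a [t] /GG'; exists t. Qed.

Let square_inj_bigcup (F : set (set (T * T * T))) :
  (forall G, F G -> square_inj G) -> total_on F subset ->
  square_inj (\bigcup_(G in F) G).
Proof.
move=> FP tot.
have both x y : (\bigcup_(G in F) G) x -> (\bigcup_(G in F) G) y ->
    exists G, [/\ F G, G x & G y].
  move=> [G FG Gx] [G' FG' G'y]; have [s|s] := tot _ _ FG FG'.
    by exists G'; split => //; exact: s.
  by exists G; split => //; exact: s.
have up G : F G -> base G `<=` base (\bigcup_(G in F) G).
  by move=> FG; apply: base_sub; exact: bigcup_sup.
split.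
- by move=> a [t [G FG Gt]]; have [+ _ _ _ _] := FP _ FG; apply; exists t.
- move=> a b t [G FG Gt]; have [_ + _ _ _] := FP _ FG.
  by move=> /(_ _ _ _ Gt) [? ? ?]; split; exact: (up G).
- move=> a b [t Ga] [t' Gb]; have [G [FG Ga' Gb']] := both _ _ Ga Gb.
  have [_ _ + _ _] := FP _ FG; move=> /(_ a b).
  by case; [exists t|exists t'|move=> u Gu; exists u; exists G].
- move=> p t t' Ga Gb; have [G [FG Ga' Gb']] := both _ _ Ga Gb.
  by have [_ _ _ + _] := FP _ FG; apply; eauto.
- move=> p p' t Ga Gb; have [G [FG Ga' Gb']] := both _ _ Ga Gb.
  by have [_ _ _ _] := FP _ FG; apply; eauto.
Qed.

(** Let [B] carry a maximal injection. If the rest of [A] embeds into [B], then [A] is no larger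
    than [B]; otherwise [B] has a copy in the rest of [A], and the injection extends to [B] with
    this copy, against maximality. *)
Lemma infinite_square : infinite_set A -> A `*` A #<= A.
Proof.
move=> /[dup] infA /infiniteP; have [a0 Aa0] := infinite_setN0 infA.
move=> /card_le_fun[|e eA einj]; first by exists a0.
have {}eA n : A (e n) by exact: eA.
have {}einj n m : e n = e m -> n = m by move=> /einj; apply; rewrite inE.
pose G0 : set (T * T * T) :=
  [set (e p.1, e p.2, e (pickle p)) | p in [set: nat * nat]].
have b0 : base G0 = range e.
  apply/seteqP; split=> [_ [t [[n m] _ [<- _ _]]]|_ [n _ <-]]; first by exists n.
  by exists (e (pickle (n, n))); exists (n, n).
have G0P : square_inj G0.
  rewrite /square_inj b0; split.
  - by move=> _ [n _ <-].
  - by move=> _ _ _ [[n m] _ [<- <- <-]]; split; apply: imageP.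
  - by move=> _ _ [n _ <-] [m _ <-]; exists (e (pickle (n, m))), (n, m).
  - by move=> _ _ t' [[n m] _ [<- <-]] [[n' m'] _ [/einj -> /einj -> <-]].
  - move=> _ _ _ [[n m] _ [<- <-]] [[n' m'] _ [<- /einj h]].
    by move/(pcan_inj pickleK) : h => [-> ->].
pose P := [set G | G = set0 \/ G0 `<=` G /\ square_inj G].
have [F FP Ftot|G [GP Gmax]] := @Zorn_bigcup _ P.
  pose F' := F `&` [set G | G0 `<=` G /\ square_inj G].
  have -> : \bigcup_(G in F) G = \bigcup_(G in F') G.
    apply/seteqP; split=> [p [G FG Gp]|p [G [FG _] Gp]]; last by exists G.
    exists G => //; split=> //; have [G00|//] := FP _ FG.
    by rewrite G00 in Gp.
  have [->|] := eqVneq F' set0; first by left; rewrite bigcup_set0.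
  by move=> /set0P[G F'G]; right; split; [move=> p G0p; exists G => //; apply F'G
      |apply: square_inj_bigcup => [? []? []//|G1 G2 [? _] [? _]]; exact: Ftot].
have {GP}[GP0 {}GP] : G0 `<=` G /\ square_inj G.
  case: GP => // G00; exfalso; apply: (Gmax G0); last by right; split.
  rewrite G00; split=> // s; have := s (e 0%N, e 0%N, e (pickle (0, 0)%N)).
  by apply; exists (0%N, 0%N).
have [GA Gb Gtot Gfun Ginj] := GP.
pose B := base G; rewrite -/B in GA Gb Gtot.
have eB n : B (e n) by apply: (base_sub GP0); rewrite b0; exists n.
pose e0 := e 0%N; pose e1 := e 1%N; pose e2 := e 2%N.
have [Be0 Be1 Be2] : [/\ B e0, B e1 & B e2] by split; exact: eB.
have [e01 e02 e12] : [/\ e0 <> e1, e0 <> e2 & e1 <> e2] by split=> /einj.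
have /choice[q0 q0P] : forall p : T * T, exists t, B p.1 -> B p.2 -> G (p, t).
  move=> [a b]; have [[Ba Bb]|] := pselect (B a /\ B b).
    by have [t] := Gtot _ _ Ba Bb; exists t.
  by move=> /not_andP[]?; exists a.
pose q a b := q0 (a, b).
have qP a b : B a -> B b -> G (a, b, q a b) by move=> ? ?; exact: q0P.
have qB a b : B a -> B b -> B (q a b).
  by move=> Ba Bb; have [] := Gb _ _ _ (qP _ _ Ba Bb).
have qinj a b a' b' : B a -> B b -> B a' -> B b' -> q a b = q a' b' ->
    a = a' /\ b = b'.
  move=> Ba Bb Ba' Bb' h; have h1 := qP _ _ Ba Bb; rewrite h in h1.
  by have [-> ->] := Ginj _ _ _ h1 (qP _ _ Ba' Bb').
have BB : B `*` B #<= B.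
  apply: (@card_le_rel _ _ _ _ (fun p t => q p.1 p.2 = t)).
    by move=> [a b] [/= Ba Bb]; exists (q a b) => //; exact: qB.
  move=> [a b] [a' b'] t [/= Ba Bb] [/= Ba' Bb'] <- /esym/qinj.
  by case=> // -> ->.
have [BD|DB] := card_le_total B (A `\` B); last first.
  suff AB : A #<= B.
    apply: card_le_trans (card_leX AB AB) _; apply: card_le_trans BB _.
    exact: subset_card_le.
  have [|i iB iinj] := card_le_fun _ DB; first by exists e0.
  (* The tags [e0] and [e1] keep the images of [B] and of the rest of [A] apart. *)
  apply: (@card_le_rel _ _ _ _
      (fun a t => B a /\ t = q e0 a \/ ~ B a /\ t = q e1 (i a))).
    move=> a Aa; have [Ba|nBa] := pselect (B a).
      by exists (q e0 a); [exact: qB|left].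
    by exists (q e1 (i a)); [apply: qB => //; exact: iB|right].
  move=> a a' t Aa Aa' [[Ba ->]|[Ba ->]] [[Ba' h]|[Ba' h]].
  - by have [] := qinj _ _ _ _ Be0 Ba Be0 Ba' h.
  - by have [] := qinj _ _ _ _ Be0 Ba Be1 (iB _ (conj Aa' Ba')) h.
  - by have [/esym] := qinj _ _ _ _ Be1 (iB _ (conj Aa Ba)) Be0 Ba' h.
  - have [_] := qinj _ _ _ _ Be1 (iB _ (conj Aa Ba)) Be1 (iB _ (conj Aa' Ba')) h.
    by apply: iinj; rewrite inE.
have [|j jB jinj] := card_le_fun _ BD.
  apply: contrapT => /set0P/negP; rewrite negbK => /eqP D0.
  by move: BD; rewrite D0 card_le0 => /eqP B0; move: Be0; rewrite B0.
have {}jinj a b : B a -> B b -> j a = j b -> a = b.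
  by move=> Ba Bb; apply: jinj; rewrite inE.
have jA a : B a -> A (j a) by move=> /jB[].
have jN a : B a -> ~ B (j a) by move=> /jB[].
(* [B] and its disjoint copy [j @` B] carry a larger injection: the three new
   parts of the square go to three disjoint parts of [j @` B]. *)
pose G' := G `|` ([set (a, j b, j (q e0 (q a b))) | a in B & b in B]
  `|` ([set (j a, b, j (q e1 (q a b))) | a in B & b in B]
  `|` [set (j a, j b, j (q e2 (q a b))) | a in B & b in B])).
exfalso; apply: (Gmax G').
  split=> [|sGG]; first exact: subsetUl.
  have /Gb[_ /(jN _ Be0)//] : G (e0, j e0, j (q e0 (q e0 e0))).
  by apply: sGG; right; left; exists e0 => //; exists e0.
right; split; first by apply: subset_trans GP0 _; exact: subsetUl.
have bG' : base G' = B `|` j @` B.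
  apply/seteqP; split.
    move=> a [t [/Gb[]|]]; first by left.
    case=> [[x Bx [y By [<- _ _]]]|]; first by left.
    case=> [[x Bx [y By [_ <- _]]]|]; first by left.
    by move=> [x Bx [y By [<- _ _]]]; right; exists x.
  move=> b [|[a Ba <-]]; first by apply: base_sub; exact: subsetUl.
  exists (j (q e2 (q a a))); right; right; right.
  by exists a => //; exists a.
rewrite /square_inj bG'; split.
- by move=> b [/GA|[a /jA ? <-]].
- move=> a b t [/Gb[? ? ?]|]; first by split; left.
  case=> [[x Bx [y By [<- <- <-]]]|].
    split; [by left|by right; exists y|right].
    by exists (q e0 (q x y)) => //; do ?apply/qB.
  case=> [[x Bx [y By [<- <- <-]]]|[x Bx [y By [<- <- <-]]]].
    by split; [right; exists x|left|right; exists (q e1 (q x y)) => //; do ?apply/qB].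
  by split; [right; exists x|right; exists y
    |right; exists (q e2 (q x y)) => //; do ?apply/qB].
- move=> a b [Ba|[{}a Ba <-]] [Bb|[{}b Bb <-]].
  + by exists (q a b); left; exact: qP.
  + by exists (j (q e0 (q a b))); right; left; exists a => //; exists b.
  + by exists (j (q e1 (q a b))); right; right; left; exists a => //; exists b.
  + by exists (j (q e2 (q a b))); right; right; right; exists a => //; exists b.
- move=> [a b] t t'.
  case=> [/[dup] /Gb[? ? ?] g|[[x Bx [y By [ea eb <-]]]|
    [[x Bx [y By [ea eb <-]]]|[x Bx [y By [ea eb <-]]]]]];
  case=> [/[dup] /Gb[? ? ?] g'|[[x' Bx' [y' By' [ea' eb' <-]]]|
    [[x' Bx' [y' By' [ea' eb' <-]]]|[x' Bx' [y' By' [ea' eb' <-]]]]]]; subst;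
  try match goal with h1 : B (j ?z), h2 : B ?z |- _ =>
    by case: (jN _ h2 h1) end;
  try (by exact: Gfun g g');
  by repeat match goal with h : j ?u = j ?v |- _ =>
    have ? : u = v by [exact: jinj]; clear h end; subst.
- have qq c x y x' y' c' : B c -> B x -> B y -> B x' -> B y' -> B c' ->
      j (q c (q x y)) = j (q c' (q x' y')) -> [/\ c = c', x = x' & y = y'].
    move=> Bc Bx By Bx' By' Bc' /jinj h.
    have {}h := h (qB _ _ Bc (qB _ _ Bx By)) (qB _ _ Bc' (qB _ _ Bx' By')).
    have [<- h'] := qinj _ _ _ _ Bc (qB _ _ Bx By) Bc' (qB _ _ Bx' By') h.
    by have [<- <-] := qinj _ _ _ _ Bx By Bx' By' h'.
  move=> [a b] [a' b'] t.
  case=> [/[dup] /Gb[? ? ?] g|[[x Bx [y By [<- <- h]]]|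
    [[x Bx [y By [<- <- h]]]|[x Bx [y By [<- <- h]]]]]];
  case=> [/[dup] /Gb[? ? ?] g'|[[x' Bx' [y' By' [<- <- h']]]|
    [[x' Bx' [y' By' [<- <- h']]]|[x' Bx' [y' By' [<- <- h']]]]]];
  try (by exact: Ginj g g'); subst t;
  try match goal with h1 : B (j ?z) |- _ =>
    by case: (jN z _ h1); do ?apply/qB end;
  match goal with h1 : j _ = j _ |- _ =>
    by case: (qq _ _ _ _ _ _ _ _ _ _ _ _ h1) => // *; congruence end.
Qed.

End infinite_square.

Lemma card_min_mem (T : Type) (F : set (set T)) (A : set T) :
  F A -> F (card_min F).
Proof. by move=> FA; have [] := card_minP (ex_intro _ A FA). Qed.

Lemma card_min_le (T : Type) (F : set (set T)) (A : set T) :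
  F A -> card_min F #<= A.
Proof. by move=> FA; have [_] := card_minP (ex_intro _ A FA); apply. Qed.

Lemma infinite_card_le (T U : Type) (A : set T) (B : set U) :
  A #<= B -> infinite_set A -> infinite_set B.
Proof. by move=> AB infA finB; apply: infA; exact: card_le_finite finB. Qed.

Lemma setX_card_le (T U V : Type) (A : set T) (B : set U) (M : set V) :
  infinite_set M -> A #<= M -> B #<= M -> A `*` B #<= M.
Proof.
by move=> infM AM BM; apply: card_le_trans (card_leX AM BM) (infinite_square infM).
Qed.

Lemma setU_card_le (T V : Type) (A B : set T) (M : set V) :
  infinite_set M -> A #<= M -> B #<= M -> A `|` B #<= M.
Proof.
move=> infM AM BM; have bM : [set: bool] #<= M.
  by apply: card_le_trans (_ : [set: bool] #<= [set: nat]) _;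
    [exact: countableP|exact/infiniteP].
apply: card_le_trans (setX_card_le infM bM (card_lexx M)).
have [m0 Mm0] := infinite_setN0 infM.
have M0 : M !=set0 by exists m0.
have [f fA finj] := card_le_fun M0 AM; have [g gB ginj] := card_le_fun M0 BM.
apply: (@card_le_rel _ _ _ _ (fun t p =>
  A t /\ p = (true, f t) \/ B t /\ p = (false, g t))).
  by move=> t [At|Bt]; [exists (true, f t)|exists (false, g t)];
    [split=> //; exact: fA|left|split=> //; exact: gB|right].
move=> t t' p _ _ [[At ->]|[Bt ->]] [[At' h]|[Bt' h]]//.
  by case: h => /finj; apply; rewrite inE.
by case: h => /ginj; apply; rewrite inE.
Qed.

Lemma bigcup_nat_card_le (T V : Type) (D : set V) (F : V -> nat -> T) :
  infinite_set D -> [set F i n | i in D & n in [set: nat]] #<= D.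
Proof.
move=> infD; apply: card_le_trans (setX_card_le infD (card_lexx D) _); last first.
  exact/infiniteP.
apply: card_le_trans (card_image_le (fun p => F p.1 p.2) _).
by apply: subset_card_le => _ [i Di [n _ <-]]; exists (i, n).
Qed.

Section max_min.
Variables (T U : Type) (A : set T) (B : set U).

Let cinl : @inl T U @` A #= A.
Proof. by apply: inj_card_eq => ? ? _ _ []. Qed.

Let cinr : @inr T U @` B #= B.
Proof. by apply: inj_card_eq => ? ? _ _ []. Qed.

Lemma maxc_lub (V : Type) (M : set V) : A #<= M -> B #<= M -> maxc A B #<= M.
Proof.
by move=> AM BM; rewrite /maxc; case: ifP => _;
  rewrite ?(card_le_eql cinl)// (card_le_eql cinr).
Qed.

Lemma minc_glb (V : Type) (M : set V) : M #<= A -> M #<= B -> M #<= minc A B.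
Proof.
by move=> AM BM; rewrite /minc; case: ifP => _;
  rewrite ?(card_le_eqr cinl)// (card_le_eqr cinr).
Qed.

Lemma maxc_ub : A #<= maxc A B /\ B #<= maxc A B.
Proof.
rewrite /maxc; have [AB|BA] := card_le_total A B.
  by rewrite AB !(card_le_eqr cinr) AB card_lexx.
case: ifP => [AB|_]; first by rewrite !(card_le_eqr cinr) AB card_lexx.
by rewrite !(card_le_eqr cinl) BA card_lexx.
Qed.

Lemma minc_lb : minc A B #<= A /\ minc A B #<= B.
Proof.
rewrite /minc; have [AB|BA] := card_le_total A B.
  by rewrite AB !(card_le_eql cinl) AB card_lexx.
case: ifP => [AB|_]; first by rewrite !(card_le_eql cinl) AB card_lexx.
by rewrite !(card_le_eql cinr) BA card_lexx.
Qed.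

End max_min.

(** * Relational systems *)

Section relational_systems.

Definition unbounded_families (X Y : Type) (R : X -> Y -> Prop) : set (set X) :=
  [set A | forall y, exists2 x, A x & ~ R x y].

Definition dominating_families (X Y : Type) (R : X -> Y -> Prop) : set (set Y) :=
  [set D | forall x, exists2 y, D y & R x y].

Definition bnum (X Y : Type) (R : X -> Y -> Prop) : set X :=
  card_min (unbounded_families R).

Definition dnum (X Y : Type) (R : X -> Y -> Prop) : set Y :=
  card_min (dominating_families R).

(** Makes [bnum] a genuine minimum: the whole of [X] is then an unbounded family, and [card_min]
    does not return its default. [serial_rel] does the same for [dnum]. *)
Definition unbounded_rel (X Y : Type) (R : X -> Y -> Prop) :=
  forall y, exists x, ~ R x y.

Definition serial_rel (X Y : Type) (R : X -> Y -> Prop) :=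
  forall x, exists y, R x y.

Definition tukey (X Y X' Y' : Type) (R : X -> Y -> Prop) (R' : X' -> Y' -> Prop) :=
  exists u v, forall x y, R' (u x) y -> R x (v y).

Lemma bnumP (X Y : Type) (R : X -> Y -> Prop) : unbounded_rel R ->
  forall y, exists2 x, bnum R x & ~ R x y.
Proof.
move=> Ru; apply: (@card_min_mem _ (unbounded_families R) setT).
by move=> y; have [x] := Ru y; exists x.
Qed.

Lemma dnumP (X Y : Type) (R : X -> Y -> Prop) : serial_rel R ->
  forall x, exists2 y, dnum R y & R x y.
Proof.
move=> Ru; apply: (@card_min_mem _ (dominating_families R) setT).
by move=> y; have [x] := Ru y; exists x.
Qed.

Variables (X Y X' Y' : Type) (R : X -> Y -> Prop) (R' : X' -> Y' -> Prop).

Lemma tukey_unbounded : tukey R R' -> unbounded_rel R -> unbounded_rel R'.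
Proof.
move=> [u [v uv]] Ru y; have [x Rx] := Ru (v y).
by exists (u x); apply: contra_not Rx; exact: uv.
Qed.

Lemma tukey_serial : tukey R R' -> serial_rel R' -> serial_rel R.
Proof.
by move=> [u [v uv]] Ru x; have [y Rx] := Ru (u x); exists (v y); exact: uv.
Qed.

Lemma tukey_bnum : tukey R R' -> unbounded_rel R -> bnum R' #<= bnum R.
Proof.
move=> [u [v uv]] Ru; apply: card_le_trans (card_image_le u _).
apply: card_min_le => y; have [x bx Rx] := bnumP Ru (v y).
by exists (u x); [exists x|apply: contra_not Rx; exact: uv].
Qed.

Lemma tukey_dnum : tukey R R' -> serial_rel R' -> dnum R #<= dnum R'.
Proof.
move=> [u [v uv]] Ru; apply: card_le_trans (card_image_le v _).
apply: card_min_le => x; have [y dy Rx] := dnumP Ru (u x).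
by exists (v y); [exists y|exact: uv].
Qed.

End relational_systems.

Lemma tukey_trans (X Y X' Y' X'' Y'' : Type) (R : X -> Y -> Prop)
    (R' : X' -> Y' -> Prop) (R'' : X'' -> Y'' -> Prop) :
  tukey R R' -> tukey R' R'' -> tukey R R''.
Proof.
move=> [u [v uv]] [u' [v' uv']]; exists (u' \o u), (v \o v') => x y /uv'.
exact: uv.
Qed.

(** * Sequential and parallel composition of relations *)

Section sequential_composition.
Variables (X Y X1 Y1 X2 Y2 : Type) (R : X -> Y -> Prop).
Variables (R1 : X1 -> Y1 -> Prop) (R2 : X2 -> Y2 -> Prop).
Variables (H : X1 -> X2 -> X) (G : Y -> Y1) (K : Y -> X1 -> Y2).
Hypothesis HGK : forall x1 x2 y,
  R (H x1 x2) y -> R1 x1 (G y) \/ R2 x2 (K y x1).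

(** Against a bound [y], first [x1] is chosen escaping [G y], then [x2] escaping [K y x1]. The pairs
    from two unbounded families are counted by the square of [M], hence by [M]. *)
Lemma sequential_bnum (V : Type) (M : set V) : infinite_set M ->
  unbounded_rel R1 -> unbounded_rel R2 -> bnum R1 #<= M -> bnum R2 #<= M ->
  bnum R #<= M.
Proof.
move=> infM u1 u2 b1 b2; apply: card_le_trans (setX_card_le infM b1 b2).
apply: card_le_trans (card_image_le (fun p => H p.1 p.2) _).
apply: card_min_le => y; have [x1 bx1 Rx1] := bnumP u1 (G y).
have [x2 bx2 Rx2] := bnumP u2 (K y x1).
by exists (H x1 x2); [exists (x1, x2)|move=> /HGK[]].
Qed.

(** If the bounds [G y] fail to dominate, some [x1] escapes all of them; with this [x1] fixed, the
    bounds [K y x1] dominate. *)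
Lemma sequential_dnum : serial_rel R -> dnum R1 #<= dnum R \/ dnum R2 #<= dnum R.
Proof.
move=> sR; have [|nd1] := pselect (dominating_families R1 (G @` dnum R)).
  by move=> d1; left; apply: card_le_trans (card_image_le G _); exact: card_min_le.
have [x1 nx1] : exists x1, forall y, dnum R y -> ~ R1 x1 (G y).
  move: nd1 => /existsNP[x1 nx1]; exists x1 => y dy R1x1.
  by apply: nx1; exists (G y) => //; exists y.
right; apply: card_le_trans (card_image_le (K ^~ x1) _); apply: card_min_le => x2.
have [y dy /HGK[/(nx1 _ dy)//|R2x]] := dnumP sR (H x1 x2).
by exists (K y x1) => //; exists y.
Qed.

End sequential_composition.

Section parallel_composition.
Variables (X Y X' Y' : Type) (R : X -> Y -> Prop) (R' : X' -> Y' -> Prop).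
Variables (u1 u2 : X -> X') (v : Y' -> Y' -> Y).
Hypothesis uv : forall x y1 y2, R' (u1 x) y1 -> R' (u2 x) y2 -> R x (v y1 y2).

(** If [x] escapes [v y y], then [u1 x] or [u2 x] escapes [y], so the two images of an unbounded
    family are together unbounded. *)
Lemma parallel_bnum : unbounded_rel R -> infinite_set (bnum R) ->
  bnum R' #<= bnum R.
Proof.
move=> uR infR; apply: card_le_trans (setU_card_le infR
  (card_image_le u1 _) (card_image_le u2 _)).
apply: card_min_le => y; have [x bx Rx] := bnumP uR (v y y).
have [R1|R1] := pselect (R' (u1 x) y); last by exists (u1 x) => //; left; exists x.
exists (u2 x); first by right; exists x.
by apply: contra_not Rx; exact: uv.
Qed.

Lemma parallel_dnum : serial_rel R' -> infinite_set (dnum R') ->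
  dnum R #<= dnum R'.
Proof.
move=> sR infR; apply: card_le_trans (setX_card_le infR (card_lexx _) (card_lexx _)).
apply: card_le_trans (card_image_le (fun p => v p.1 p.2) _).
apply: card_min_le => x; have [y1 d1 R1] := dnumP sR (u1 x).
have [y2 d2 R2] := dnumP sR (u2 x).
by exists (v y1 y2); [exists (y1, y2)|exact: uv].
Qed.

End parallel_composition.

(** * Sigma-ideals as relational systems *)

Section sigma_ideals.
Variables (Y P : Type) (J : set (set Y)).

(** Bounds are arbitrary sets; being in [J] is a clause of the relation, so that a set outside [J]
    bounds nothing. *)
Definition mem_rel (x : Y) (A : set Y) := J A /\ A x.

Lemma non_mem_rel : sigma_ideal J -> non J = bnum mem_rel.
Proof.
move=> [J0 Jsub _]; congr card_min; apply/seteqP; split=> A /= AJ.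
  move=> B; apply: contrapT => /forall2NP h; apply: AJ.
  have [JB|nJB] := pselect (J B).
    by apply: Jsub JB => x Ax; have [//|/contrapT[]] := h x.
  by apply: Jsub J0 => x Ax; have [//|/contrapT[]] := h x.
by move=> JA; have [x Ax []] := AJ A.
Qed.

Lemma cov_mem_rel : serial_rel mem_rel -> cov J #= dnum mem_rel.
Proof.
move=> sJ; apply: Cantor_Bernstein; last first.
  have [|CJ cov] := @card_min_mem _
      [set C | C `<=` J /\ \bigcup_(A in C) A = setT] J.
    split=> //; apply/seteqP; split=> // x _.
    by have [A [JA Ax]] := sJ x; exists A.
  apply: card_min_le => x; have : setT x by [].
  by rewrite -cov => -[A CA Ax]; exists A => //; split=> //; exact: CJ.
(* A dominating family may contain sets outside [J]; discarding them leaves a cover by members of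
   [J]. *)
apply: card_le_trans (_ : dnum mem_rel `&` J #<= _); last exact/subset_card_le.
apply: card_min_le; split; first by move=> A [].
apply/seteqP; split=> // x _; have [A dA [JA Ax]] := dnumP sJ x.
by exists A.
Qed.

Lemma sigma_ideal_smallest (F : set (set Y)) :
  sigma_ideal (smallest (@sigma_ideal Y) F).
Proof.
split.
- by move=> K [[]].
- by move=> A B AB JB K KP; have [[_ Ksub _] _] := KP; apply: Ksub AB _; exact: JB.
- by move=> A JA K KP; have [[_ _ +] _] := KP; apply => n; exact: JA.
Qed.

Variables (G : P -> set Y) (ok : set P).

Definition gen_rel (x : Y) (p : P) := ok p /\ G p x.

Hypothesis ok0 : ok !=set0.
Hypothesis Gdir : forall f : nat -> P, (forall n, ok (f n)) ->
  exists2 p, ok p & forall n, G (f n) `<=` G p.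

Let Jgen := smallest (@sigma_ideal Y) [set G p | p in ok].

(** As the generators are countably directed, the subsets of single generators are already closed
    under countable unions. *)
Lemma smallest_sigma_idealE :
  Jgen = [set A | exists2 p, ok p & A `<=` G p].
Proof.
apply/seteqP; split.
  apply: smallest_sub; last by move=> _ [p okp <-]; exists p.
  split.
  - by have [p okp] := ok0; exists p.
  - by move=> A B AB [p okp Bp]; exists p => //; exact: subset_trans Bp.
  - move=> A AJ; have /choice[f fP] : forall n, exists p, ok p /\ A n `<=` G p.
      by move=> n; have [p] := AJ n; exists p.
    have [|p okp fp] := Gdir (f := f); first by move=> n; have [] := fP n.
    by exists p => // x [n _]; have [_ /(_ x)/[apply]/fp] := fP n.
move=> A [p okp Ap] K [[_ Ksub _] GK]; apply: Ksub Ap _.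
by apply: GK; exists p.
Qed.

End sigma_ideals.

(** * Initial segments and eventual domination *)

Lemma nearooP (P : nat -> Prop) :
  (\forall n \near \oo, P n) <-> exists N, forall n, (N <= n)%N -> P n.
Proof.
split=> [[N _ NP]|[N NP]]; first by exists N => n Nn; exact: NP.
by exists N => // n /= Nn; exact: NP.
Qed.

Lemma not_nearoo (P : nat -> Prop) :
  ~ (\forall n \near \oo, P n) -> forall N, exists2 n, (N <= n)%N & ~ P n.
Proof.
move=> nP N; apply: contrapT => /forall2NP h; apply: nP; apply/nearooP.
by exists N => n Nn; have [//|/contrapT] := h n.
Qed.

Lemma countable_range (T : Type) (A : set T) :
  countable A -> A !=set0 -> exists f : nat -> T, A = range f.
Proof. by move=> /pfcard_geP[->[]//|/surjfunPex]. Qed.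

Lemma mkseqS (T : Type) (f : nat -> T) n : mkseq f n.+1 = rcons (mkseq f n) (f n).
Proof. by rewrite /mkseq -addn1 iotaD map_cat cats1. Qed.

Lemma take_mkseq (T : Type) (f : nat -> T) n m : (n <= m)%N ->
  take n (mkseq f m) = mkseq f n.
Proof. by move=> nm; rewrite /mkseq -map_take take_iota (minn_idPl nm). Qed.

(** The initial segments, not the values, are iterated, so that each step has the whole past at
    hand. *)
Lemma mkseq_recursion (X : Type) (c : seq X -> X) :
  exists x : nat -> X, forall n, x n = c (mkseq x n).
Proof.
pose s n := iter n (fun t => rcons t (c t)) [::].
exists (fun n => c (s n)) => n; congr c.
by elim: n => // n IH; rewrite mkseqS -IH.
Qed.

Lemma boundingE : bounding = bnum le_star.
Proof.
congr card_min; apply/seteqP; split=> F /= h.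
  move=> g; apply: contrapT => /forall2NP nf; apply: h; exists g => f Ff.
  by have [|/contrapT] := nf f.
by move=> [g gF]; have [f Ff []] := h g; exact: gF.
Qed.

Lemma countable_bounded (F : set (nat -> nat)) : countable F ->
  exists g, forall f, F f -> le_star f g.
Proof.
have [->|/set0P F0] := eqVneq F set0; first by exists id.
move=> /countable_range/(_ F0)[f ->]; exists (fun n => \max_(i < n.+1) f i n).
move=> _ [k _ <-]; apply/nearooP; exists k => n kn.
by rewrite (leq_bigmax (Ordinal (kn : (k < n.+1)%N))).
Qed.

Lemma unbounded_le_star : unbounded_rel le_star.
Proof.
move=> g; exists (fun n => (g n).+1) => /nearooP[N /(_ N (leqnn _))].
by rewrite ltnn.
Qed.

Lemma serial_le_star : serial_rel le_star.
Proof. by move=> f; exists f; apply/nearooP; exists 0%N. Qed.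

Lemma infinite_bnum_le_star : infinite_set (bnum le_star).
Proof.
move=> /finite_set_countable/countable_bounded[g gP].
by have [f /gP] := bnumP unbounded_le_star g.
Qed.

(* The functions with a given initial segment [s] that obey [g] from then on are the
   branches of a finitely branching tree, and there are countably many [s]. *)
Lemma predicted_bounded (g : seq nat -> nat) : exists G : nat -> nat, forall f,
  (\forall n \near \oo, (f n <= g (mkseq f n))%N) -> le_star f G.
Proof.
(* [ext t] lists the one-step extensions of [t] that obey [g], [B s k] the nodes [k] levels above
   [s], and [bd s n] bounds [g] on level [n]. *)
pose ext t := [seq rcons t v | v <- iota 0 (g t).+1].
pose B s k := iter k (fun b => flatten (map ext b)) [:: s].
pose bd s n := \max_(t <- B s (n - size s)%N) g t.
(* The segment with code [i] counts for [n >= i]; a number that codes no segment contributes 0. *)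
exists (fun n => \max_(i < n.+1) oapp (bd ^~ n) 0%N (unpickle i)).
move=> f /nearooP[N NP]; apply/nearooP.
exists (maxn N (pickle (mkseq f N))) => n; rewrite geq_max => /andP[Nn pn].
apply: leq_trans (NP _ Nn) _.
apply: (bigop.bigmax_sup (Ordinal (pn : (_ < n.+1)%N))) => //.
rewrite [nat_of_ord _]/= pickleK [oapp _ _ _]/= /bd size_mkseq -{1}(subnKC Nn).
have : mkseq f (N + (n - N)) \in B (mkseq f N) (n - N)%N.
  elim: (n - N)%N => [|k IH]; first by rewrite addn0 mem_seq1.
  rewrite addnS mkseqS; apply/flattenP; exists (ext (mkseq f (N + k))).
    exact: map_f.
  by apply: map_f; rewrite mem_iota add0n ltnS NP ?leq_addr.
by move=> h; apply: (leq_bigmax_seq _ h).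
Qed.

(** * Invariants of sigma-ideals with countably directed generators *)

Section generated_sigma_ideal.
Variables (Y P : Type) (G : P -> set Y) (ok : set P).
Hypothesis ok0 : ok !=set0.
Hypothesis Gdir : forall f : nat -> P, (forall n, ok (f n)) ->
  exists2 p, ok p & forall n, G (f n) `<=` G p.
Hypothesis unbounded_gen : unbounded_rel (gen_rel G ok).
Hypothesis serial_gen : serial_rel (gen_rel G ok).

Let J := smallest (@sigma_ideal Y) [set G p | p in ok].

Let JE : J = [set A | exists2 p, ok p & A `<=` G p].
Proof. exact: smallest_sigma_idealE. Qed.

Let gen_mem : tukey (gen_rel G ok) (mem_rel J).
Proof.
have [p0 okp0] := ok0.
have /choice[v vP] : forall A, exists p, J A -> ok p /\ A `<=` G p.
  move=> A; have [|nJA] := pselect (J A); last by exists p0.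
  by rewrite JE => -[p okp Ap]; exists p.
by exists id, v => x A [/vP[okv vA] Ax]; split=> //; exact: vA.
Qed.

Let mem_gen : tukey (mem_rel J) (gen_rel G ok).
Proof.
by exists id, G => x p [okp Gpx]; split=> //; rewrite JE; exists p.
Qed.

Let sigmaJ : sigma_ideal J := sigma_ideal_smallest _.

Lemma non_gen_rel : non J #= bnum (gen_rel G ok).
Proof.
rewrite (non_mem_rel sigmaJ); apply: Cantor_Bernstein; apply: tukey_bnum => //.
exact: tukey_unbounded unbounded_gen.
Qed.

Lemma cov_gen_rel : cov J #= dnum (gen_rel G ok).
Proof.
have s : serial_rel (mem_rel J) by exact: tukey_serial serial_gen.
apply: card_eq_trans (cov_mem_rel s) _.
by apply: Cantor_Bernstein; apply: tukey_dnum.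
Qed.

(** A countable dominating family of generators would be absorbed by a single generator, which some
    point escapes. *)
Lemma uncountable_dnum_gen_rel : ~ countable (dnum (gen_rel G ok)).
Proof.
pose D := dnum (gen_rel G ok) `&` ok.
have D0 : D !=set0.
  have [p okp] := ok0; have [x _] := unbounded_gen p.
  by have [q dq [okq _]] := dnumP serial_gen x; exists q.
move=> /(sub_countable (subset_card_le (@subIsetl _ _ ok))).
move=> /countable_range/(_ D0)[f fD].
have [|p okp fp] := Gdir (f := f).
  by move=> n; have [] : D (f n) by rewrite /D fD; exists n.
have [x []] := unbounded_gen p; split=> //.
have [q dq [okq Gqx]] := dnumP serial_gen x.
have : D q by [].
by rewrite /D fD => -[n _ fnq]; apply: (fp n); rewrite fnq.
Qed.

End generated_sigma_ideal.

(** * The M- and K-ideals over an arbitrary ideal *)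

Section ideal_sequences.
Variables (X : Type) (I : set (set X)).
Hypothesis idealI : ideal I.

Definition M_rel := gen_rel (@M_gen X) [set phi | forall s, I (phi s)].
Definition K_rel := gen_rel (@K_gen X) [set phi | forall n, I (phi n)].

Let I0 : I set0.
Proof. by have [+ _ _ _] := idealI; apply; exact: finite_set0. Qed.

Let IU A B : I A -> I B -> I (A `|` B).
Proof. by have [_ _ _] := idealI; apply. Qed.

Let bigI n (A : nat -> set X) : (forall k, I (A k)) ->
  I [set x | exists2 k, (k < n)%N & A k x].
Proof.
move=> IA; elim: n => [|n IH].
  by rewrite (_ : mkset _ = set0)//; apply/seteqP; split=> x [].
rewrite (_ : mkset _ = [set x | exists2 k, (k < n)%N & A k x] `|` A n).
  exact: IU.
apply/seteqP; split=> x /=.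
  move=> [k]; rewrite ltnS leq_eqVlt => /orP[/eqP->|kn] Akx; first by right.
  by left; exists k.
by move=> [[k kn Akx]|Anx]; [exists k => //; exact: ltnW|exists n].
Qed.

Let singleton_in x : exists A, I A /\ A x.
Proof.
by exists [set x]; split=> //; have [+ _ _ _] := idealI; apply; exact: finite_set1.
Qed.

(** A bound for [K_rel] becomes a bound for [M_rel] that depends only on the length of the initial
    segment. *)
Lemma tukey_M_K : tukey M_rel K_rel.
Proof.
exists id, (fun phi s => phi (size s)) => x phi [okphi xphi]; split=> [s|].
  exact: okphi.
by rewrite /M_gen /=; near=> n; rewrite size_mkseq; near: n.
Unshelve. all: by end_near. Qed.

(** Diagonalisation: a branch is built whose next value always lies outside the set that [phi]
    assigns to its past. *)
Lemma unbounded_M_rel : unbounded_rel M_rel.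
Proof.
have outside A : I A -> exists x, ~ A x.
  move=> IA; apply: contrapT => /forallNP AT; have [_ + _ _] := idealI; apply.
  rewrite (_ : setT = A)//; apply/seteqP; split=> // x _.
  by apply: contrapT; exact: AT.
have [x0 _] := outside _ I0.
move=> phi; have [okphi|nok] := pselect (forall s, I (phi s)); last first.
  by exists (fun=> x0) => -[].
have /choice[c cP] : forall s, exists y, ~ phi s y by move=> s; exact: outside.
have [x xc] := mkseq_recursion c; exists x => -[_ /nearooP[N /(_ N (leqnn _)) h]].
by apply: (cP (mkseq x N)); rewrite -xc.
Qed.

Lemma unbounded_K_rel : unbounded_rel K_rel.
Proof. exact: tukey_unbounded tukey_M_K unbounded_M_rel. Qed.

Lemma serial_K_rel : serial_rel K_rel.
Proof.
move=> x; have /choice[phi phiP] : forall n, exists A, I A /\ A (x n).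
  by move=> n; exact: singleton_in.
exists phi; split=> [n|]; first by have [] := phiP n.
by apply/nearooP; exists 0%N => n _; have [] := phiP n.
Qed.

Lemma serial_M_rel : serial_rel M_rel.
Proof. exact: tukey_serial tukey_M_K serial_K_rel. Qed.

Let M_ok0 : [set phi : seq X -> set X | forall s, I (phi s)] !=set0.
Proof. by exists (fun=> set0). Qed.

Let K_ok0 : [set phi : nat -> set X | forall s, I (phi s)] !=set0.
Proof. by exists (fun=> set0). Qed.

(** Diagonal union: at length [n] only the first [n + 1] functions are joined, so the values are
    finite unions of members of [I], and each function is included from some length on. *)
Let M_dir (f : nat -> seq X -> set X) : (forall n s, I (f n s)) ->
  exists2 p, (forall s, I (p s)) & forall n, M_gen (f n) `<=` M_gen p.
Proof.
move=> If; exists (fun s => [set x | exists2 k, (k < (size s).+1)%N & f k s x]).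
  by move=> s; apply: bigI.
move=> n x /nearooP[N xN]; apply/nearooP; exists (maxn n N) => m.
rewrite geq_max => /andP[nm Nm]; exists n; last exact: xN.
by rewrite size_mkseq ltnS.
Qed.

Let K_dir (f : nat -> nat -> set X) : (forall n s, I (f n s)) ->
  exists2 p, (forall s, I (p s)) & forall n, K_gen (f n) `<=` K_gen p.
Proof.
move=> If; exists (fun s => [set x | exists2 k, (k < s.+1)%N & f k s x]).
  by move=> s; apply: bigI.
move=> n x /nearooP[N xN]; apply/nearooP; exists (maxn n N) => m.
by rewrite geq_max => /andP[nm Nm]; exists n; last exact: xN.
Qed.

Lemma M_idealE :
  M_ideal I = [set A | exists2 phi, (forall s, I (phi s)) & A `<=` M_gen phi].
Proof. exact: smallest_sigma_idealE M_ok0 M_dir. Qed.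

Lemma non_M_rel : non (M_ideal I) #= bnum M_rel.
Proof. exact: non_gen_rel M_ok0 M_dir unbounded_M_rel. Qed.

Lemma cov_M_rel : cov (M_ideal I) #= dnum M_rel.
Proof. exact: cov_gen_rel M_ok0 M_dir serial_M_rel. Qed.

Lemma non_K_rel : non (K_ideal I) #= bnum K_rel.
Proof. exact: non_gen_rel K_ok0 K_dir unbounded_K_rel. Qed.

Lemma cov_K_rel : cov (K_ideal I) #= dnum K_rel.
Proof. exact: cov_gen_rel K_ok0 K_dir serial_K_rel. Qed.

Lemma infinite_dnum_M_rel : infinite_set (dnum M_rel).
Proof.
move=> /finite_set_countable.
exact: uncountable_dnum_gen_rel M_ok0 M_dir unbounded_M_rel serial_M_rel.
Qed.

(** A set of elements with bounded code is finite, hence in [I]. *)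
Lemma tukey_K_le_star : countable [set: X] -> tukey K_rel le_star.
Proof.
have [+ _ _ _] := idealI => Ifin /countable_injP[e einj].
exists (fun x n => e (x n)), (fun g n => [set y | (e y <= g n)%N]).
move=> x g xg; split=> // n; apply: Ifin.
apply: (@card_le_finite _ _ _ `I_(g n).+1); last exact: finite_II.
apply: (@card_le_rel _ _ _ _ (fun y k => k = e y)).
  by move=> y yg; exists (e y).
by move=> y y' k _ _ -> /einj; apply; rewrite inE.
Qed.

End ideal_sequences.

(** * The ideal Fin x Fin *)

Lemma finite_nat_bound (A : set nat) : finite_set A ->
  exists N, forall n, A n -> (n <= N)%N.
Proof.
move=> /finite_seqP[s ->]; exists (\max_(i <- s) i) => n ns.
by apply: (leq_bigmax_seq _ ns).
Qed.

(** Initial columns and the region under a graph: either [a] bounds the first coordinate, or [g]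
    bounds the second in terms of the first, which suits prediction value by value. *)
Lemma FinFinP (A : set (nat * nat)) : FinFin A <->
  exists a g, forall k m, A (k, m) -> (k <= a)%N \/ (m <= g k)%N.
Proof.
split=> [/nearooP[N NA]|[a [g Aag]]].
  have /choice[g gP] : forall k, exists b, (N <= k)%N ->
      forall m, A (k, m) -> (m <= b)%N.
    move=> k; have [Nk|_] := leqP N k; last by exists 0%N.
    by have [b bP] := finite_nat_bound (NA _ Nk); exists b.
  exists N, g => k m Akm; have [|/ltnW Nk] := leqP k N; first by left.
  by right; exact: gP.
apply/nearooP; exists a.+1 => k ak.
apply: (@sub_finite_set _ _ `I_(g k).+1); last exact: finite_II.
by move=> m /= /Aag[|//]; rewrite leqNgt ak.
Qed.

Lemma ideal_FinFin : ideal FinFin.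
Proof.
split.
- move=> A /finite_seqP[s ->]; apply/FinFinP; exists 0%N.
  exists (fun=> \max_(p <- s) p.2) => k m kms; right.
  by apply: (leq_bigmax_seq _ kms).
- move=> /nearooP[N /(_ N (leqnn _))]; rewrite (_ : mkset _ = setT).
    exact: infinite_nat.
  exact/seteqP.
- move=> A B AB /FinFinP[a [g Bag]]; apply/FinFinP; exists a, g => k m /AB.
  exact: Bag.
- move=> A B /FinFinP[a [g Aag]] /FinFinP[b [h Bbh]]; apply/FinFinP.
  exists (maxn a b), (fun k => maxn (g k) (h k)) => k m; rewrite !leq_max.
  by case=> [/Aag|/Bbh] [] ->; rewrite ?orbT; auto.
Qed.

Lemma FinFin_bounds : exists (a : set (nat * nat) -> nat)
    (g : set (nat * nat) -> nat -> nat),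
  forall A k m, FinFin A -> A (k, m) -> (k <= a A)%N \/ (m <= g A k)%N.
Proof.
have /choice[ag agP] : forall A, exists ag : nat * (nat -> nat), FinFin A ->
    forall k m, A (k, m) -> (k <= ag.1)%N \/ (m <= ag.2 k)%N.
  move=> A; have [/FinFinP[a [g Aag]]|] := pselect (FinFin A).
    by exists (a, g).
  by exists (0%N, fun=> 0%N).
by exists (fun A => (ag A).1), (fun A => (ag A).2) => A k m FA; exact: agP.
Qed.

(** * The K-ideal of Fin x Fin and domination *)

Section FinFin_K.

Let mono (h : nat -> nat) n := \max_(i < n.+1) h i.

(* If [f] exceeds [a (phi _)] infinitely often, [nxt n >= n] is such an index, and a
   monotone [h] is bounded at [n] by its value at [nxt n]. *)
Lemma K_FinFin_sequential : exists (G : (nat -> set (nat * nat)) -> nat -> nat)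
    (H : (nat -> nat) -> (nat -> nat) -> nat -> nat * nat)
    (K : (nat -> set (nat * nat)) -> (nat -> nat) -> nat -> nat),
  forall f h phi, K_rel FinFin (H f h) phi ->
    le_star f (G phi) \/ le_star h (K phi f).
Proof.
have [a [g agP]] := FinFin_bounds.
pose G (phi : nat -> set (nat * nat)) n := a (phi n).
have /choice[K KP] : forall phif : (nat -> set (nat * nat)) * (nat -> nat),
    exists k, forall h, K_rel FinFin (fun n => (phif.2 n, mono h n)) phif.1 ->
      le_star phif.2 (G phif.1) \/ le_star h k.
  move=> [phi f] /=; have [fG|nfG] := pselect (le_star f (G phi)).
    by exists id => h _; left.
  have /choice[nxt nxtP] : forall n, exists m, (n <= m)%N /\ ~ (f m <= G phi m)%N.
    by move=> n; have [m] := not_nearoo nfG n; exists m.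
  exists (fun n => g (phi (nxt n)) (f (nxt n))) => h [okphi /nearooP[N hN]].
  right; apply/nearooP; exists N => n Nn; have [nm nG] := nxtP n.
  have [//|] := agP _ _ _ (okphi _) (hN _ (leq_trans Nn nm)).
  move=> hg; apply: leq_trans hg.
  exact: (bigop.bigmax_sup (Ordinal (nm : (n < (nxt n).+1)%N))).
exists G, (fun f h n => (f n, mono h n)), (fun phi f => K (phi, f)) => f h phi.
exact: (KP (phi, f)).
Qed.

End FinFin_K.

(** Both components of the sequential composition are [le_star], so the maximum is the bounding
    number itself. *)
Lemma non_K_FinFin : non (K_ideal FinFin) #= bounding.
Proof.
rewrite boundingE; apply: card_eq_trans (non_K_rel ideal_FinFin) _.
have [G [H [K GHK]]] := K_FinFin_sequential.
apply: Cantor_Bernstein.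
  by apply: (sequential_bnum GHK) => //;
    [exact: infinite_bnum_le_star|exact: unbounded_le_star|exact: unbounded_le_star].
apply: tukey_bnum; last exact: unbounded_K_rel ideal_FinFin.
by apply: tukey_K_le_star; [exact: ideal_FinFin|exact: countableP].
Qed.

Lemma cov_K_FinFin : cov (K_ideal FinFin) #= dominating.
Proof.
apply: card_eq_trans (cov_K_rel ideal_FinFin) _.
have [G [H [K GHK]]] := K_FinFin_sequential.
apply: Cantor_Bernstein.
  apply: tukey_dnum; last exact: serial_le_star.
  by apply: tukey_K_le_star; [exact: ideal_FinFin|exact: countableP].
by have [] := sequential_dnum GHK (serial_K_rel ideal_FinFin).
Qed.

(** * The M-ideal of Fin x Fin and constant prediction *)

Section FinFin_M.

Let flat (s : seq (nat * nat)) := flatten [seq [:: z.1; z.2] | z <- s].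

Let flat_rcons s z : flat (rcons s z) = rcons (rcons (flat s) z.1) z.2.
Proof. by rewrite /flat -cats1 map_cat flatten_cat -!cats1 -catA. Qed.

(** The coordinates of [x n] become the values at [2n] and [2n + 1]. A success in the window
    starting at [2n] bounds the first coordinate, or the second given the first, and such pairs form
    a set in [FinFin]. *)
Let tukey_M_predicted : tukey (M_rel FinFin) (predicted_le 2).
Proof.
pose u (x : nat -> nat * nat) j := if odd j then (x j./2).2 else (x j./2).1.
pose v (p : predictor) s : set (nat * nat) := [set z |
  (z.1 <= p (flat s))%N \/ (z.2 <= p (rcons (flat s) z.1))%N].
have uS x n : u x n.*2.+1 = (x n).2 by rewrite /u /= odd_double uphalf_double.
have u2 x n : u x n.*2 = (x n).1 by rewrite /u odd_double doubleK.
have mku x n : mkseq (u x) n.*2 = flat (mkseq x n).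
  elim: n => // n IH; rewrite doubleS 3!mkseqS IH flat_rcons.
  by rewrite uS u2.
exists u, v => x p /nearooP[N NP]; split.
  move=> s; apply/FinFinP; exists (p (flat s)), (fun k => p (rcons (flat s) k)).
  by [].
apply/nearooP; exists N => n Nn; rewrite /v /=.
have [|j [/andP[nj jn]]] := NP n.*2; first by lia.
have /orP[/eqP->|/eqP->] : (j == n.*2) || (j == n.*2.+1) by lia.
  by rewrite u2 mku; left.
by rewrite mkseqS u2 uS mku; right.
Qed.

Let half_seq (f : nat -> nat) n := (f n.*2, f n.*2.+1).

Let tail_seq (f : nat -> nat) n := f n.+1.

Let unflat (t : seq nat) :=
  mkseq (fun i => (nth 0%N t i.*2, nth 0%N t i.*2.+1)) (size t)./2.

Let unflat_mkseq f n : unflat (mkseq f n) = mkseq (half_seq f) n./2.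
Proof.
rewrite /unflat size_mkseq; apply/eq_in_map => i; rewrite mem_iota => /andP[_ ni].
by rewrite !nth_mkseq//; lia.
Qed.

(** Pairing [f] from its start handles the windows at even positions, pairing its shift those at odd
    positions; the larger of the two predictions serves both. *)
Let predicted_parallel : exists v,
  forall f phi psi, M_rel FinFin (half_seq f) phi ->
    M_rel FinFin (half_seq (tail_seq f)) psi -> predicted_le 2 f (v phi psi).
Proof.
have [a [g agP]] := FinFin_bounds.
(* The parity of the length tells which coordinate comes next; for the second one, the first is the
   last value of [t]. *)
pose p phi (t : seq nat) := if odd (size t)
  then g (phi (unflat t)) (last 0%N t) else a (phi (unflat t)).
have pP f phi : M_rel FinFin (half_seq f) phi -> \forall n \near \oo,
    (f n.*2 <= p phi (mkseq f n.*2))%N \/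
    (f n.*2.+1 <= p phi (mkseq f n.*2.+1))%N.
  move=> [okphi /nearooP[N NP]]; apply/nearooP; exists N => n Nn.
  have dS : n.*2.+1./2 = n by exact: uphalf_double.
  rewrite /p !size_mkseq oddS odd_double !unflat_mkseq doubleK dS.
  by rewrite mkseqS last_rcons; exact: agP (okphi _) (NP _ Nn).
(* [behead] turns a segment of [f] into one of its shift. *)
exists (fun phi psi t => maxn (p phi t) (p psi (behead t))).
move=> f phi psi /pP/nearooP[N0 N0P] /pP/nearooP[N1 N1P].
have mkt n : mkseq (tail_seq f) n = behead (mkseq f n.+1).
  by rewrite /mkseq /= -(addn0 1%N) iotaDl -map_comp.
apply/nearooP; exists (maxn N0 N1).*2.+1 => i Ni.
rewrite -[i]odd_double_half; case: (odd i) => /=.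
  have [|H|H] := N1P i./2; first by lia.
    by exists i./2.*2.+1; rewrite leq_max -mkt H orbT; split=> //; lia.
  by exists i./2.*2.+2; rewrite leq_max -mkt H orbT; split=> //; lia.
have [|H|H] := N0P i./2; first by lia.
  by exists i./2.*2; rewrite leq_max H; split=> //; lia.
by exists i./2.*2.+1; rewrite leq_max H; split=> //; lia.
Qed.

Let unbounded_predicted : unbounded_rel (predicted_le 2).
Proof. exact: tukey_unbounded tukey_M_predicted (unbounded_M_rel ideal_FinFin). Qed.

(** Transfers from [le_star] that the unbounding number of prediction is infinite and that
    prediction is serial. *)
Let tukey_predicted_le_star : tukey (predicted_le 2) le_star.
Proof.
exists id, (fun g s => g (size s)) => f g /nearooP[N NP]; apply/nearooP.
exists N => i Ni; exists i; rewrite size_mkseq NP//.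
by rewrite leqnn addn2 ltnS leqnSn.
Qed.

Lemma non_M_FinFin : non (M_ideal FinFin) #= e_const_le 2.
Proof.
apply: card_eq_trans (non_M_rel ideal_FinFin) _.
have [v vP] := predicted_parallel.
apply: Cantor_Bernstein.
  apply: (parallel_bnum vP) => //.
  apply: infinite_card_le infinite_bnum_le_star.
  exact: tukey_bnum.
exact: tukey_bnum tukey_M_predicted (unbounded_M_rel ideal_FinFin).
Qed.

Lemma cov_M_FinFin : cov (M_ideal FinFin) #= v_const_le 2.
Proof.
apply: card_eq_trans (cov_M_rel ideal_FinFin) _.
have [v vP] := predicted_parallel.
apply: Cantor_Bernstein.
  apply: tukey_dnum tukey_M_predicted _.
  exact: tukey_serial tukey_predicted_le_star serial_le_star.
apply: (parallel_dnum vP); first exact: serial_M_rel ideal_FinFin.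
exact: infinite_dnum_M_rel ideal_FinFin.
Qed.

End FinFin_M.

Local Open Scope ring_scope.



(** * Binary expansions and coin tossing *)

Definition bval (s : seq bool) : nat := foldl (fun a (b : bool) => (a.*2 + b)%N) 0%N s.

Lemma bval_rcons s b : bval (rcons s b) = ((bval s).*2 + b)%N.
Proof. by rewrite /bval -cats1 foldl_cat. Qed.

Lemma ltn_bval s : (bval s < 2 ^ size s)%N.
Proof.
elim/last_ind: s => // s b IH; rewrite bval_rcons size_rcons expnS.
by case: b; lia.
Qed.

Lemma bval_inj s t : size s = size t -> bval s = bval t -> s = t.
Proof.
elim/last_ind: s t => [|s b IH] t; first by move/esym/size0nil.
case/lastP: t => [|t c]; first by rewrite size_rcons.
rewrite !size_rcons !bval_rcons => -[st] e.
have /(IH _ st) -> : bval s = bval t by case: b c e => [] []; lia.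
by congr rcons; case: b c e => [] []; lia.
Qed.

(** * Dyadic intervals and the outer measure on Cantor space *)

Section dyadic.
Variable R : realType.
Implicit Types (b : R) (m : int) (s : seq bool).

(* The binary digits of the fractional part of [b]. *)
Definition bits b : cantor_space :=
  fun i => Num.floor (2 ^+ i.+1 * b) != 2 * Num.floor (2 ^+ i * b).

Lemma floor_bits b n : Num.floor (2 ^+ n * b) =
  2 ^+ n * Num.floor b + (bval (mkseq (bits b) n))%:Z.
Proof.
elim: n => [|n IH]; first by rewrite !expr0 !mul1r addr0.
rewrite mkseqS bval_rcons.
have /andP[h1 h2] := floor_itv (2 ^+ n * b).
set F := Num.floor (2 ^+ n * b) in IH h1 h2.
have : Num.floor (2 ^+ n.+1 * b) = 2 * F + (bits b n)%:Z.
  rewrite /bits -/F; case: eqVneq => [->|]/=; first by rewrite addr0.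
  have -> : 2 ^+ n.+1 * b = 2 * (2 ^+ n * b) by rewrite exprS mulrA.
  set x := 2 ^+ n * b in h1 h2 *; move=> ne.
  have : 2 * F <= Num.floor (2 * x).
    by rewrite floor_ge_int intrM ler_pM2l.
  have : Num.floor (2 * x) < 2 * (F + 1).
    by rewrite floor_lt_int intrM ltr_pM2l.
  by move: ne; lia.
move=> ->; rewrite IH exprS; lia.
Qed.

(** The copy of a cylinder in [m, m+1): through these intervals, lower bounds for [cantor_measure]
    are drawn from Lebesgue measure. *)
Definition dyadic m s : set R :=
  [set b | Num.floor b = m /\ mkseq (bits b) (size s) = s].

Lemma dyadic_itv m s : dyadic m s =
  [set` `[2^-1 ^+ size s * (2 ^+ size s * m + (bval s)%:Z)%:~R,
          2^-1 ^+ size s * (2 ^+ size s * m + (bval s)%:Z + 1)%:~R [].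
Proof.
have p2 n : 0 < (2 : R) ^+ n by rewrite exprn_gt0.
have itv b (k : int) n : (2^-1 ^+ n * k%:~R <= b < 2^-1 ^+ n * (k + 1)%:~R) =
    (Num.floor (2 ^+ n * b) == k).
  rewrite floor_eq exprVn ![_^-1 * _]mulrC ler_pdivrMr// ltr_pdivlMr//.
  by rewrite ![b * _]mulrC.
apply/seteqP; split=> b /=; rewrite in_itv/= itv.
  by move=> [<- <-]; rewrite size_mkseq -floor_bits.
have bs := ltn_bval s; move=> /eqP; rewrite floor_bits => e.
have := ltn_bval (mkseq (bits b) (size s)); rewrite size_mkseq => bb.
have fm : Num.floor b = m.
  have P2 k : (2 ^ k)%N%:Z = 2 ^+ k by rewrite -natz natrX.
  move: e bs bb; rewrite -!ltz_nat !P2.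
  set v := bval _; set w := bval _; set q := (2 ^+ _ : int).
  move=> e bs bb; have q0 : 0 < q by rewrite exprn_gt0.
  (* Both values lie in [0, q), so a multiple of [q] equal to their difference is 0. *)
  have : q * (Num.floor b - m) = w%:Z - v%:Z by lia.
  by move: (Num.floor b) => f; nia.
split=> //; apply: bval_inj; first by rewrite size_mkseq.
by move: e; rewrite fm; lia.
Qed.

Lemma measurable_dyadic m s : measurable (dyadic m s).
Proof. by rewrite dyadic_itv. Qed.

Lemma lebesgue_dyadic m s :
  lebesgue_measure (dyadic m s) = (2^-1 ^+ size s)%:E.
Proof.
rewrite dyadic_itv lebesgue_measure_itv/= lte_fin ltr_pM2l ?exprn_gt0//.
rewrite ltr_int ltrDl ltr01 -EFinB -mulrBr; congr EFin.
by rewrite !intrD addrAC subrr add0r mulr1.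
Qed.

Lemma lebesgue_bigcup_dyadic m n (S : {set n.-tuple bool}) :
  lebesgue_measure (\bigcup_(t in [set` S]) dyadic m t) =
  (#|S|%:R * 2^-1 ^+ n)%:E.
Proof.
have -> : [set` S] = [set` enum S] by apply/seteqP; split=> t /=; rewrite mem_enum.
rewrite measure_fin_bigcup//=.
- rewrite -fsbig_seq ?enum_uniq// big_enum/=.
  under eq_bigr do rewrite lebesgue_dyadic size_tuple.
  by rewrite sumEFin sumr_const mulr_natl.
- move=> t u _ _ [b [[_ bt] [_ bu]]]; apply: val_inj => /=.
  by rewrite -bt -bu !size_tuple.
- by move=> t _; exact: measurable_dyadic.
Qed.

Lemma measurable_bigcup_dyadic m n (S : {set n.-tuple bool}) :
  measurable (\bigcup_(t in [set` S]) dyadic m t).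
Proof. by apply: fin_bigcup_measurable => // t _; exact: measurable_dyadic. Qed.

(** A cover of [A] gives dyadic intervals covering those of [S], and Lebesgue measure is countably
    subadditive. *)
Lemma card_le_cantor_measure n (S : {set n.-tuple bool}) (A : set cantor_space) :
  (forall x (t : n.-tuple bool), t \in S -> mkseq x n = t -> A x) ->
  ((#|S|%:R * 2^-1 ^+ n)%:E <= cantor_measure R A)%E.
Proof.
move=> SA; apply: le_ereal_inf_tmp => _ [c Ac <-].
rewrite -(lebesgue_bigcup_dyadic 0 S).
apply: (@le_trans _ _ (\sum_(0 <= k <oo) lebesgue_measure (dyadic 0 (c k)))%E).
  apply: measure_sigma_subadditive => //.
  - by move=> k; exact: measurable_dyadic.
  - exact: measurable_bigcup_dyadic.
  - move=> b [t /= tS [b0 bt]]; rewrite size_tuple in bt.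
    have [k _ ck] := Ac _ (SA _ _ tS bt).
    by exists k.
by apply: lee_nneseries => // k _; rewrite lebesgue_dyadic.
Qed.

Lemma half_exp_lt (e : R) : 0 < e -> exists n, 2^-1 ^+ n < e.
Proof.
move=> e0; have [N _ /(_ N (leqnn _))] := near_infty_natSinv_expn_lt (PosNum e0).
by rewrite /= div1r -exprVn => Ne; exists N.
Qed.

Lemma cantor_measure_le (l : seq (seq bool)) (A : set cantor_space) :
  (forall x, A x -> exists2 t, t \in l & mkseq x (size t) = t) ->
  (cantor_measure R A <= (\sum_(t <- l) 2^-1 ^+ size t)%:E)%E.
Proof.
move=> lA; apply/lee_addgt0Pr => e e0; have [M Me] := half_exp_lt e0.
pose K := size l.
(* Covers are infinite sequences: past the list come filler words of length [M + j + 1], whose total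
   weight is at most 2^-M, below [e]. *)
pose c j := if (j < K)%N then nth [::] l j else nseq (M + j.+1) false.
pose w j : \bar R := (if (j < K)%N then 2^-1 ^+ size (nth [::] l j) else 0)%:E.
apply: ge_ereal_inf; exists (\sum_(0 <= j <oo) (2^-1 ^+ size (c j))%:E)%E.
  exists c => // x /lA[t tl xt]; exists (index t l) => //.
  by rewrite /c index_mem tl nth_index.
apply: (@le_trans _ _ (\sum_(0 <= j <oo) (w j + (e / (2 ^ j.+1)%:R)%:E))%E).
  apply: lee_nneseries => [j _ _|j _]; first by rewrite lee_fin exprn_ge0.
  have e2 : 0 <= e / (2 ^ j.+1)%:R by rewrite divr_ge0// ltW.
  rewrite /w /c; case: ifPn => _; rewrite -EFinD lee_fin ?lerDl// size_nseq add0r.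
  by rewrite exprD natrX -exprVn ler_wpM2r ?exprn_ge0// ltW.
have w0 j : (0 <= w j)%E by rewrite /w lee_fin; case: ifP => // _; rewrite exprn_ge0.
apply: le_trans (epsilon_trick _ w0 (ltW e0)) _; rewrite leeD2r//.
rewrite (nneseries_split _ K)// add0n [X in (_ + X)%E]eseries0 ?adde0; last first.
  by move=> j Kj _; rewrite /w ltnNge Kj.
rewrite /w sumEFin lee_fin (big_nth [::]) le_eqVlt; apply/orP; left; apply/eqP.
by apply: eq_big_nat => j /andP[_ ->].
Qed.

Lemma cantor_measure_ge0 (A : set cantor_space) : (0 <= cantor_measure R A)%E.
Proof.
apply: le_ereal_inf_tmp => _ [c _ <-]; apply: nneseries_ge0 => n _ _.
by rewrite lee_fin exprn_ge0.
Qed.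

End dyadic.

(* König's lemma, used instead of compactness. *)
Lemma cantor_uniform_level (P : nat -> cantor_space -> Prop) :
  (forall n x y, mkseq x n = mkseq y n -> P n x -> P n y) ->
  (forall n m x, (n <= m)%N -> P n x -> P m x) ->
  (forall x, exists n, P n x) -> exists n, forall x, P n x.
Proof.
move=> Ploc Pmono Pex; apply: contrapT => /forallNP nP.
pose bad (s : seq bool) := forall n, exists x : cantor_space,
  mkseq x (size s) = s /\ ~ P n x.
have bad0 : bad [::] by move=> n; have /existsNP[x] := nP n; exists x.
have badS s : bad s -> exists b, bad (rcons s b).
  move=> bs; apply: contrapT => /forallNP nb.
  have /existsNP[n0 n0P] := nb false; have /existsNP[n1 n1P] := nb true.
  (* If neither extension of [s] is bad, [P] holds above both of them from the larger of the two
     levels on. *)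
  have [x [xs nPx]] := bs (maxn n0 n1).
  have xb : mkseq x (size s).+1 = rcons s (x (size s)) by rewrite mkseqS xs.
  case: (x _) xb => xb; [apply: n1P|apply: n0P];
    exists x; rewrite size_rcons; split=> //; apply: contra_not nPx;
    by apply: Pmono; rewrite ?leq_maxl ?leq_maxr.
have /choice[c cP] : forall s, exists b, bad s -> bad (rcons s b).
  by move=> s; have [/badS[b]|] := pselect (bad s); [exists b|exists true].
have [x xc] := mkseq_recursion c.
have xbad n : bad (mkseq x n).
  by elim: n => // n IH; rewrite mkseqS [in X in rcons _ X]xc; exact: cP.
have [n Pn] := Pex x; have [y [yx]] := xbad n n.
by apply; apply: Ploc Pn; rewrite -[in LHS]yx size_mkseq.
Qed.

(** * Open and clopen sets of Cantor space by levels *)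

Lemma near_mkseq (x : cantor_space) n :
  \forall y \near x, mkseq y n = mkseq x n.
Proof.
elim: n => [|n IH]; first by apply: filterE => y.
have xn : \forall y \near x, y n = x n.
  exact: (@proj_continuous nat (fun=> bool) n x _ (discrete_set1 (x n))).
by apply: filterS2 IH xn => y yn e; rewrite !mkseqS yn e.
Qed.

Lemma clopen_level n (S : seq bool -> Prop) :
  clopen [set x : cantor_space | S (mkseq x n)].
Proof.
have op (Q : seq bool -> Prop) : open [set x : cantor_space | Q (mkseq x n)].
  rewrite openE => x /= Qx; apply: filterS (near_mkseq x n) => y /= ->.
  exact: Qx.
split=> //; rewrite -[X in closed X]setCK; apply: open_closedC.
exact: (op (fun s => ~ S s)).
Qed.

Lemma open_cylinder (U : set cantor_space) (x : cantor_space) : open U -> U x ->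
  exists n, forall y : cantor_space, mkseq y n = mkseq x n -> U y.
Proof.
move=> oU Ux; apply: contrapT => /forallNP nU.
have /choice[y yP] : forall n, exists y : cantor_space,
    mkseq y n = mkseq x n /\ ~ U y.
  by move=> n; have /existsNP[y /not_implyP] := nU n; exists y.
have yx : y @ \oo --> x.
  apply/cvg_sup => i V [W] [[Q] oQ <-] Qxi QV; apply: filterS QV _.
  apply/nearooP; exists i.+1 => n ni; rewrite /preimage/=.
  suff -> : y n i = x i by [].
  by have [/(congr1 (nth false ^~ i))] := yP n; rewrite !nth_mkseq.
have /nearooP[n /(_ n (leqnn _))] := yx _ (open_nbhs_nbhs (conj oU Ux)).
by have [] := yP n.
Qed.

(** Each point has a cylinder inside [U] or inside its complement, and one level serves all
    points. *)
Lemma clopen_uniform_level (U : set cantor_space) : clopen U ->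
  exists n, forall x y : cantor_space, mkseq x n = mkseq y n -> U x -> U y.
Proof.
move=> [oU cU]; have oC : open (~` U) by exact: closed_openC.
pose P n (x : cantor_space) := forall y z : cantor_space, mkseq y n = mkseq x n ->
  mkseq z n = mkseq x n -> U y -> U z.
have [||x|n nP] := @cantor_uniform_level P.
- by move=> n x y e Px z t; rewrite -e; exact: Px.
- move=> n m x nm Px y z /(congr1 (take n)) ex /(congr1 (take n)) ez.
  by apply: Px; move: ex ez; rewrite !take_mkseq.
- have [Ux|nUx] := pselect (U x).
    have [n nU] := open_cylinder oU Ux; exists n => y z _ zx _; exact: nU.
  have [n nU] := open_cylinder oC nUx; exists n => y z yx _ Uy.
  by have := nU _ yx.
by exists n => x y xy; apply: (nP x).
Qed.

Definition prefix (x : cantor_space) n : n.-tuple bool :=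
  Tuple (introT eqP (size_mkseq x n)).

Definition pad (s : seq bool) : cantor_space := nth false s.

Lemma mkseq_pad s : mkseq (pad s) (size s) = s.
Proof. exact: mkseq_nth. Qed.


(** * Reals given by binary sequences *)

Section real_of_bits.
Variable R : realType.

Lemma bval_mkseq_itv (x : cantor_space) n k :
  (bval (mkseq x n) * 2 ^ k <= bval (mkseq x (n + k)) <
   (bval (mkseq x n)).+1 * 2 ^ k)%N.
Proof.
elim: k => [|k IH]; first by rewrite addn0 !muln1 leqnn ltnS leqnn.
by rewrite addnS mkseqS bval_rcons expnS; case: (x _); lia.
Qed.

Definition bits_real (x : cantor_space) : R :=
  sup [set (2^-1 ^+ n * (bval (mkseq x n))%:R : R) | n in [set: nat]].

(** Every lower truncation is at most every upper one. The right end is included because of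
    expansions ending in ones. *)
Lemma bits_real_itv x n :
  2^-1 ^+ n * (bval (mkseq x n))%:R <= bits_real x <=
  2^-1 ^+ n * (bval (mkseq x n)).+1%:R.
Proof.
pose E : set R := [set 2^-1 ^+ n * (bval (mkseq x n))%:R | n in [set: nat]].
rewrite /bits_real -/E.
have ub m k : 2^-1 ^+ m * (bval (mkseq x m))%:R <=
    2^-1 ^+ k * (bval (mkseq x k)).+1%:R :> R.
  have le i j (a b : nat) : (a * 2 ^ j <= b * 2 ^ i)%N ->
      2^-1 ^+ i * a%:R <= 2^-1 ^+ j * b%:R :> R.
    move=> ab; rewrite !exprVn ![_^-1 * _]mulrC ler_pdivrMr ?exprn_gt0//.
    rewrite mulrAC ler_pdivlMr ?exprn_gt0//.
    by rewrite -!natrX -!natrM ler_nat.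
  apply: le; have [mk|/ltnW km] := leqP m k.
    have /andP[+ _] := bval_mkseq_itv x m (k - m); rewrite subnKC// => h.
    rewrite -(subnK mk) expnD mulnA leq_mul2r expn_eq0/=.
    by apply: leq_trans h _; rewrite subnK.
  have /andP[_] := bval_mkseq_itv x k (m - k); rewrite subnKC// => h.
  rewrite -[X in (_ <= _ * 2 ^ X)%N](subnK km) expnD mulnA leq_mul2r expn_eq0/=.
  exact: ltnW.
have supE : has_sup E.
  split; first by exists (2^-1 ^+ 0 * (bval (mkseq x 0))%:R), 0%N.
  by exists (2^-1 ^+ 0 * (bval (mkseq x 0)).+1%:R) => _ [k _ <-].
apply/andP; split; first by apply: ub_le_sup; [exact: supE.2|exists n].
by apply: ge_sup; [exact: supE.1|move=> _ [k _ <-]].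
Qed.

(** [A] lies in an open set [U] of measure below 1/2. [W n] collects the words whose closed dyadic
    interval is inside [U]: measure bounds their number, and openness catches each point of [A] from
    some level on. *)
Lemma null_bits_real (A : set R) : null_ideal R A ->
  exists W : forall n, {set n.-tuple bool},
    (forall n, (2 * #|W n| <= 2 ^ n)%N) /\
    (forall x, A (bits_real x) -> \forall n \near \oo, prefix x n \in W n).
Proof.
move=> [B [mB B0 AB]].
have [||U [oU BU UB]] := @lebesgue_regularity_outer R B 2^-1 mB.
- by rewrite [X in (X < _)%E]B0 ltry.
- by rewrite invr_gt0.
have mU : measurable U by exact: measurable_realfun.open_measurable.
have U2 : (lebesgue_measure U < (2^-1 : R)%:E)%E.
  apply: le_lt_trans UB; rewrite -[leRHS]adde0 -B0.
  apply: (@le_trans _ _ (lebesgue_measure (U `\` B `|` B))).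
    rewrite le_measure ?inE//; first by apply: measurableU => //; exact: measurableD.
    by move=> x Ux; have [Bx|nBx] := pselect (B x); [right|left].
  by apply: measureU2 => //; exact: measurableD.
pose W n := finset (fun t : n.-tuple bool => `[< forall z : R,
  2^-1 ^+ n * (bval t)%:R <= z <= 2^-1 ^+ n * (bval t).+1%:R -> U z >]).
exists W; split=> [n|x Ax].
  have : ((#|W n|%:R * 2^-1 ^+ n)%:E <= (2^-1 : R)%:E)%E.
    rewrite -(lebesgue_bigcup_dyadic R 0); apply: le_trans (ltW U2).
    rewrite le_measure ?inE//; first exact: measurable_bigcup_dyadic.
    move=> z [t /=]; rewrite inE => /asboolP tU zt; apply: tU; move: zt.
    rewrite dyadic_itv size_tuple mulr0 add0r /= in_itv/= -PoszD addn1 -!pmulrn.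
    by move=> /andP[-> /ltW].
  rewrite lee_fin exprVn ler_pdivrMr ?exprn_gt0// -(ler_pM2l (ltr0n R 2))//.
  by rewrite mulrA mulfV ?pnatr_eq0// mul1r -natrX -natrM ler_nat.
have [e /= e0 eU] := (nbhs_ballP _ _).1 (open_nbhs_nbhs (conj oU (BU _ (AB _ Ax)))).
have [N Ne] := half_exp_lt e0; apply/nearooP; exists N => n Nn.
rewrite inE; apply/asboolP => z /andP[z1 z2]; apply: eU => /=.
have /andP[x1 x2] := bits_real_itv x n.
apply: le_lt_trans Ne; apply: (@le_trans _ _ (2^-1 ^+ n)); last first.
  by rewrite ler_wiXn2l// invf_le1// ler1n.
move: z1 z2 x1 x2; rewrite /= -!natr1 !mulrDr mulr1.
set v := _ * (bval _)%:R; set q := (_ ^+ n : R) => z1 z2 x1 x2.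
by rewrite ler_norml; apply/andP; split; lra.
Qed.

End real_of_bits.

(** * The Solecki ideal *)

Section Solecki_ideal.
Variable R : realType.

(** At least 2^n words of length [n + 1] lie outside [W]; the cylinders of exactly 2^n of them form
    a clopen set of measure 1/2. *)
Lemma half_clopen_avoiding n (W : {set n.+1.-tuple bool}) :
  (2 * #|W| <= 2 ^ n.+1)%N ->
  exists U : set_type (Omega R), forall x, prefix x n.+1 \in W -> ~ set_val U x.
Proof.
move=> W2; have : (2 ^ n <= #|~: W|)%N.
  have := cardsC W; rewrite card_tuple card_bool.
  by move: W2; rewrite expnS; lia.
move=> /card_geqP[s [us ss sW]].
pose U : set cantor_space := [set x | prefix x n.+1 \in s].
have UO : Omega R U.
  split.
    have -> : U = [set x | (fun t : seq bool => t \in map val s) (mkseq x n.+1)].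
      by apply/seteqP; split=> x /=; rewrite /U/= -(mem_map val_inj).
    exact: (@clopen_level n.+1 (fun t => t \in map val s)).
  have h : (2 ^ n)%N%:R * 2^-1 ^+ n.+1 = 2^-1 :> R.
    by rewrite natrX exprS mulrCA -exprMn mulfV// expr1n mulr1.
  apply/eqP; rewrite eq_le; apply/andP; split.
    apply: le_trans (@cantor_measure_le R (map val s) U _) _.
      move=> x xs; exists (mkseq x n.+1); last by rewrite size_mkseq.
      exact: (map_f val xs).
    rewrite big_map (eq_bigr (fun=> 2^-1 ^+ n.+1)) => [|t _].
      rewrite big_const_seq count_predT iter_addr_0 ss.
      by rewrite lee_fin -[leLHS]mulr_natl h.
    by rewrite size_tuple.
  rewrite -h -ss -(card_uniqP us) -cardsE; apply: card_le_cantor_measure => x t.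
  rewrite inE => ts xt; rewrite /U /=; have -> // : prefix x n.+1 = t.
  exact: val_inj.
exists (exist _ U (mem_set UO)) => x xW /sW; rewrite inE.
by rewrite xW.
Qed.

(** Were [S] less than half of the words, its cylinders would cover [U] with total weight below
    1/2. *)
Lemma Omega_level (U : set cantor_space) : Omega R U ->
  exists n (S : {set n.-tuple bool}),
    (2 ^ n <= 2 * #|S|)%N /\ forall x, U x <-> prefix x n \in S.
Proof.
move=> [cU mU]; have [n nU] := clopen_uniform_level cU.
pose S := finset (fun t : n.-tuple bool => `[< U (pad t) >]).
have padP x : mkseq (pad (prefix x n)) n = mkseq x n.
  by rewrite -[in X in mkseq _ X](size_tuple (prefix x n)) mkseq_pad.
have US x : U x <-> prefix x n \in S.
  rewrite inE; split=> [Ux|/asboolP]; last by apply: nU; rewrite padP.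
  by apply/asboolP; apply: nU Ux; rewrite padP.
exists n, S; split=> //.
have : ((2^-1 : R)%:E <= (#|S|%:R * 2^-1 ^+ n)%:E)%E.
  rewrite -mU; apply: le_trans (@cantor_measure_le R (map val (enum S)) U _) _.
    move=> x /US xS; exists (mkseq x n); last by rewrite size_mkseq.
    by apply: (map_f val (x := prefix x n)); rewrite mem_enum.
  rewrite big_map (eq_bigr (fun=> 2^-1 ^+ n)) => [|t _].
    rewrite big_const_seq count_predT iter_addr_0 -cardE.
    by rewrite lee_fin mulr_natl.
  by rewrite size_tuple.
rewrite lee_fin exprVn ler_pdivlMr ?exprn_gt0// -(ler_pM2l (ltr0n R 2))//.
by rewrite mulrA mulfV ?pnatr_eq0// mul1r -natrX -natrM ler_nat.
Qed.

Lemma countable_Omega : countable [set: set_type (Omega R)].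
Proof.
have /choice[f fP] : forall U : set_type (Omega R), exists p : nat * seq (seq bool),
    forall x, set_val U x <-> mkseq x p.1 \in p.2.
  move=> U; have [n [S [_ US]]] := Omega_level (set_valP U).
  exists (n, map val (enum S)) => x; apply: iff_trans (US x) _ => /=.
  by rewrite -[mkseq x n]/(val (prefix x n)) (mem_map val_inj) mem_enum.
apply/countable_injP; exists (fun U => pickle (f U)) => U V _ _.
move=> /(pcan_inj pickleK) fUV; apply: val_inj; apply/funext => x.
apply/propext; apply: iff_trans (fP U x) _; rewrite fUV.
exact: iff_sym (fP V x).
Qed.

(** The union of the generators of the Solecki ideal given by the points of [F]. *)
Definition hit_by (F : seq cantor_space) (U : set_type (Omega R)) :=
  exists2 i, (i < size F)%N & set_val U (nth point F i).

Lemma hit_by_cat F F' U : hit_by (F ++ F') U <-> hit_by F U \/ hit_by F' U.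
Proof.
split=> [[i]|[[i iF Ui]|[i iF Ui]]].
- rewrite size_cat nth_cat => iFF; case: ltnP => [iF Ui|Fi Ui].
    by left; exists i.
  by right; exists (i - size F)%N => //; rewrite ltn_subLR.
- by exists i; [rewrite size_cat ltn_addr|rewrite nth_cat iF].
- exists (size F + i)%N; first by rewrite size_cat ltn_add2l.
  by rewrite nth_cat ltnNge leq_addr/= addKn.
Qed.

(** At level [n + 1], [n] points occupy at most [n] words, which is at most half. This makes the
    Solecki ideal proper. *)
Lemma Omega_avoiding F : exists U, ~ hit_by F U.
Proof.
pose n := size F.
pose W := finset (fun t : n.+1.-tuple bool =>
  t \in [seq prefix (nth point F i) n.+1 | i <- iota 0 n]).
have [|U UP] := @half_clopen_avoiding n W.
  have : (#|W| <= n)%N.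
    rewrite cardsE; apply: leq_trans (card_size _) _.
    by rewrite size_map size_iota.
  by rewrite expnS leq_mul2l/=; move/leq_trans; apply; rewrite ltnW// ltn_expl.
exists U => -[i iF]; apply: UP; rewrite inE; apply/mapP; exists i => //.
by rewrite mem_iota.
Qed.

Lemma Omega_neq0 (U : set_type (Omega R)) : exists x, set_val U x.
Proof.
have [_ U2] := set_valP U; apply: contrapT => /forallNP U0.
have : (cantor_measure R (set_val U) <= 0%:E)%E.
  apply: le_trans (@cantor_measure_le R [::] _ _) _; last by rewrite big_nil.
  by move=> x /U0.
by rewrite U2 lee_fin leNgt invr_gt0 ltr0n.
Qed.

(** The families hit by a finite set of points form an ideal: it is proper by [Omega_avoiding], and
    contains the finite families because members of Omega are nonempty. *)
Lemma SoleckiP (A : set (set_type (Omega R))) :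
  Solecki R A <-> exists F, A `<=` hit_by F.
Proof.
split; last first.
  move=> [F AF] K [[Kfin _ Ksub KU] Kgen]; apply: (Ksub _ _ AF).
  elim: F {AF} => [|x F IH].
    by apply: (Ksub _ set0) => [U []//|]; apply: Kfin; exact: finite_set0.
  apply: (Ksub _ ([set U | set_val U x] `|` hit_by F)).
    by rewrite -cat1s => U /hit_by_cat[[[]//= _ Ux]|]; [left|right].
  by apply: KU => //; apply: Kgen; exists x.
suff : Solecki R `<=` [set A | exists F, A `<=` hit_by F] by apply.
apply: smallest_sub.
  split.
  - move=> {}A finA; have /choice[p pP] := Omega_neq0.
    have /(@finite_seqP {classic set_type (Omega R)})[s sA] := finA.
    exists (map p s) => U; rewrite sA => Us.
    exists (index (U : {classic _}) s); rewrite ?size_map ?index_mem//.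
    by rewrite (nth_map (U : {classic _})) ?index_mem// nth_index.
  - by move=> [F TF]; have [U] := Omega_avoiding F; apply; exact: TF.
  - by move=> B C BC [F CF]; exists F; exact: subset_trans CF.
  - move=> B C [F BF] [F' CF']; exists (F ++ F') => U BCU; apply/hit_by_cat.
    by case: BCU => [/BF|/CF']; [left|right].
by move=> B [x Bx]; exists [:: x] => U BU; exists 0%N => //=; exact: Bx.
Qed.

End Solecki_ideal.

(** * Invariants of the Solecki ideal *)

Section Solecki_cardinals.
Variable R : realType.

Lemma ideal_Solecki : ideal (Solecki R).
Proof.
split.
- by move=> A finA K [[+ _ _ _] _]; apply.
- by move=> /SoleckiP[F FT]; have [U] := Omega_avoiding R F; apply; exact: FT.
- by move=> A B AB /SoleckiP[F BF]; apply/SoleckiP; exists F; exact: subset_trans BF.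
- by move=> A B SA SB K KP; have [[_ _ _ +] _] := KP; apply; [exact: SA|exact: SB].
Qed.

(** An unbounded family must cover the range of every sequence by a null set, which gives
    [cov_omega_null]; a dominating family must leave every null set, which gives [non] of the null
    ideal. *)
Definition null_noncover_rel (A : set R) (B : nat -> R) :=
  ~ (null_ideal R A /\ range B `<=` A).

Lemma countable_null (A : set R) : countable A -> null_ideal R A.
Proof.
move=> cA; exists A; split=> //; last exact: countable_lebesgue_measure0.
apply: countable_measurable => //.
Qed.

Lemma not_null_setT : ~ null_ideal R setT.
Proof.
move=> [B [mB B0 /(_ _ I) BT]].
have : (lebesgue_measure (`[0%R, 1%R]%classic : set R) <= 0)%E.
  by rewrite -B0 le_measure ?inE// => x _; exact: BT.
by rewrite lebesgue_measure_itv/= lte_fin ltr01 oppr0 adde0 lee_fin ler10.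
Qed.

Lemma unbounded_null_noncover : unbounded_rel null_noncover_rel.
Proof.
move=> B; exists (range B); apply; split=> //; apply: countable_null.
exact: card_image_le.
Qed.

Lemma serial_null_noncover : serial_rel null_noncover_rel.
Proof.
move=> A; have [nA|nA] := pselect (null_ideal R A); last by exists (fun=> 0) => -[].
have [x nAx] : exists x, ~ A x.
  apply: contrapT => /forallNP AT; apply: not_null_setT.
  by rewrite (_ : setT = A)//; apply/seteqP; split=> // x _; apply: contrapT; exact: AT.
by exists (fun=> x) => -[_ xA]; apply: nAx; apply: xA; exists 0%N.
Qed.

Lemma bnum_null_noncover : bnum null_noncover_rel #= cov_omega_null R.
Proof.
have natR : [set: nat] #= range (fun n => n%:R : R).
  apply: card_esym; apply: inj_card_eq => n m _ _ /eqP.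
  by rewrite eqr_nat => /eqP.
pose F : set (set (set R)) := [set C | C `<=` null_ideal R /\
    forall B : set R, B #= [set: nat] -> exists2 A, C A & B `<=` A].
have covF : F (bnum null_noncover_rel `&` null_ideal R).
  split=> [A []//|B B0].
  have [||f Bf] := @countable_range R B.
  - by rewrite /countable (card_le_eql B0).
  - by apply: infinite_setN0; apply/infiniteP; rewrite (card_le_eqr B0).
  have [A bA /contrapT[nA fA]] := bnumP unbounded_null_noncover f.
  by exists A; rewrite ?Bf.
apply: Cantor_Bernstein; last first.
  apply: card_le_trans (card_min_le covF) _; exact: subset_card_le.
apply: card_min_le => B.
have [CN CP] := card_min_mem covF.
(* The naturals are interleaved with [B] because [cov_omega_null] speaks of infinite sets, while the
   range of [B] may be finite. *)
pose c j : R := if odd j then j./2%:R else B j./2.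
have [|A CA cA] := CP (range c).
  apply: eq_card_nat; first exact: card_image_le.
  apply: infinite_card_le (_ : infinite_set (range (fun n => n%:R : R))).
    apply: subset_card_le => _ [n _ <-]; exists n.*2.+1 => //.
    by rewrite /c /= odd_double uphalf_double.
  by apply/infiniteP; rewrite -(card_le_eqr natR).
exists A => // -[]; split; first exact: CN.
by move=> _ [n _ <-]; apply: cA; exists n.*2; rewrite // /c odd_double doubleK.
Qed.

(** Constant sequences at the points of a non-null set dominate; conversely, the union of the ranges
    of a dominating family is not null. *)
Lemma dnum_null_noncover : dnum null_noncover_rel #= non (null_ideal R).
Proof.
have nullT : [set A | ~ null_ideal R A] [set: R] by exact: not_null_setT.
apply: Cantor_Bernstein.
  apply: card_le_trans (card_image_le (fun b (_ : nat) => b) _).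
  apply: card_min_le => A.
  have := card_min_mem nullT; set X := card_min _ => nX.
  have [nA|nA] := pselect (null_ideal R A); last first.
    have [b Xb] : X !=set0.
      apply/set0P/negP => /eqP X0; apply: nX; rewrite X0; exact: countable_null.
    by exists (fun=> b); [exists b|case].
  have [b [Xb nAb]] : exists b, X b /\ ~ A b.
    apply: contrapT => /forallNP XA; apply: nX; apply: negligibleS nA => b Xb.
    by apply: contrapT => nAb; apply: (XA b).
  exists (fun=> b); first by exists b.
  by move=> [_ bA]; apply: nAb; apply: bA; exists 0%N.
set D := dnum _.
pose X := [set B n | B in D & n in [set: nat]].
have nX : ~ null_ideal R X.
  move=> nX; have [B DB] := dnumP serial_null_noncover X; apply; split=> //.
  by move=> _ [n _ <-]; exists B => //; exists n.
apply: card_le_trans (card_min_le nX) _; apply: bigcup_nat_card_le.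
move=> /finite_set_countable cD; apply: nX; apply: countable_null.
have -> : X = \bigcup_(B in D) range B.
  by apply/seteqP; split=> _ [B DB [n _ <-]]; exists B => //; exists n.
by apply: bigcup_countable => // B _; exact: card_image_le.
Qed.

(** * Random finite sets of points and Borel-Cantelli *)

Section random_points.

(* The bits of [b] are dealt to [n] points in turn, so that these are independent;
   no independence is needed between different [n]. *)
Let point_bits (n k : nat) (b : R) : cantor_space := fun i => bits b (i * n + k).

(** The first [L] bits of the [n] points are disjoint blocks of the first [L * n] bits of [b]; each
    block avoids [S] for at most half of the words, so all do for a fraction of at most 2^-n. *)
Let card_avoiding n L (S : {set L.-tuple bool}) : (2 ^ L <= 2 * #|S|)%N ->
  exists Q : {set (L * n).-tuple bool}, (2 ^ n * #|Q| <= 2 ^ (L * n))%N /\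
    forall b, (forall k, (k < n)%N -> prefix (point_bits n k b) L \notin S) ->
      prefix (bits b) (L * n) \in Q.
Proof.
move=> S2; pose block (w : seq bool) k : L.-tuple bool :=
  [tuple nth false w (i * n + k) | i < L].
have idx_lt i k : (i < L)%N -> (k < n)%N -> (i * n + k < L * n)%N.
  move=> iL kn; apply: (@leq_trans (i.+1 * n)); last by rewrite leq_mul2r iL orbT.
  by rewrite mulSn addnC ltn_add2r.
pose Q := finset (fun w : (L * n).-tuple bool => [forall k : 'I_n, block w k \notin S]).
exists Q; split; last first.
  move=> b bS; rewrite inE; apply/forallP => k.
  have -> : block (prefix (bits b) (L * n)) k = prefix (point_bits n k b) L.
    apply: eq_from_tnth => i; rewrite tnth_mktuple (tnth_nth false)/=.
    by rewrite !nth_mkseq ?idx_lt.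
  exact: bS.
(* Bit [j] belongs to point [j %% n], at position [j %/ n], so the blocks determine the word. *)
pose g (w : (L * n).-tuple bool) := [ffun k : 'I_n => block w k].
have ginj : injective g.
  move=> w w' /ffunP gw; apply: eq_from_tnth => j.
  have n0 : (0 < n)%N.
    have := ltn_ord j; case: (posnP n) => // n0.
    by rewrite [X in (_ < X)%N](_ : _ = 0)%N// n0 muln0.
  have jn : (j %/ n < L)%N by rewrite ltn_divLR.
  have := gw (Ordinal (ltn_pmod j n0)); rewrite !ffunE.
  move=> /(congr1 (fun t => tnth t (Ordinal jn))); rewrite !tnth_mktuple /=.
  by rewrite -divn_eq !(tnth_nth false).
have : (#|Q| <= #|~: S| ^ n)%N.
  have <- : #|@ffun_on_mem 'I_n _ (mem (~: S))| = (#|~: S| ^ n)%N.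
    by rewrite card_ffun_on card_ord.
  rewrite -(card_imset _ ginj).
  apply: subset_leq_card; apply/fintype.subsetP => f /imsetP[w + ->].
  rewrite inE => /forallP wS; apply/ffun_onP => k; rewrite ffunE inE.
  exact: wS.
move=> QS; apply: leq_trans (leq_mul (leqnn _) QS) _.
rewrite -expnMn expnM; have [->|n0] := posnP n; first by rewrite !expn0.
rewrite leq_exp2r//; have := cardsC S; rewrite card_tuple card_bool.
by move: S2; lia.
Qed.

Definition escaping_reals (y : nat -> set_type (Omega R)) : set R :=
  [set b | forall N, exists n, (N <= n)%N /\
    forall k, (k < n)%N -> ~ set_val (y n) (point_bits n k b)].

(** Borel-Cantelli in each interval [m, m+1), followed by the countable union over the integers
    [m]. *)
Lemma null_escaping_reals y : null_ideal R (escaping_reals y).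
Proof.
have /choice[q qP] : forall n, exists Q : {N : nat & {set N.-tuple bool}},
    (2 ^ n * #|projT2 Q| <= 2 ^ projT1 Q)%N /\
    forall b, (forall k, (k < n)%N -> ~ set_val (y n) (point_bits n k b)) ->
      prefix (bits b) (projT1 Q) \in projT2 Q.
  move=> n; have [L [S [S2 yS]]] := Omega_level (set_valP (y n)).
  have [Q [Q2 QP]] := card_avoiding n S2.
  exists (existT _ (L * n)%N Q); split=> // b yb; apply: QP => k kn.
  by apply/negP => zS; apply: (yb _ kn); apply/yS.
pose E m n : set R := \bigcup_(t in [set` projT2 (q n)]) dyadic m (val t).
have mE m n : measurable (E m n) by exact: measurable_bigcup_dyadic.
have E0 m : lebesgue_measure (lim_sup_set (E m)) = 0%E.
  apply: lim_sup_set_cvg0; first exact: mE.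
  (* The bound 2^-n is written with denominator 2^(n+1) to match [epsilon_trick0]. *)
  apply: (@le_lt_trans _ _ (\sum_(n <oo) (2 / (2 ^ n.+1)%:R : R)%:E)%E).
    apply: lee_nneseries => // n _; 
    rewrite [leLHS](lebesgue_bigcup_dyadic R m (projT2 (q n))) lee_fin.
    have [q2 _] := qP n.
    rewrite exprVn ler_pdivrMr ?exprn_gt0// expnS natrM invfM mulrA mulfV// mul1r.
    rewrite mulrC ler_pdivlMr ?ltr0n ?expn_gt0// -natrX -natrM ler_nat mulnC.
    exact: q2.
  apply: le_lt_trans (epsilon_trick0 _ _) (ltry _) => //.
pose C j : set R := oapp (fun m => lim_sup_set (E m)) set0 (unpickle j : option int).
have nC : null_ideal R (\bigcup_j C j); last first.
  apply: negligibleS nC => b yb.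
  exists (pickle (Num.floor b)) => //; rewrite /C pickleK => N _.
  have [n [Nn nb]] := yb N; exists n => //; have [_ /(_ _ nb)] := qP n => bQ.
  by exists (prefix (bits b) (projT1 (q n))) => //; split=> //; rewrite size_tuple.
apply: negligible_bigcup => j; rewrite /C; case: unpickle => [m|] /=.
  exists (lim_sup_set (E m)); split=> //; apply: bigcap_measurable => // n _.
  by apply: bigcup_measurable => k _; exact: mE.
exact: negligible_set0.
Qed.

(** If some [B i] is not escaping, its [n] points hit [y n] for all large [n]; stage [n] uses the
    points of the first [n] reals, hence those of [B i] once [n > i]. *)
Lemma tukey_K_null_noncover : tukey (K_rel (Solecki R)) null_noncover_rel.
Proof.
pose pts (B : nat -> R) n := mkseq
  (fun j => point_bits n (j %% n) (B (j %/ n)%N)) (n * n).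
exists escaping_reals, (fun B n => hit_by (pts B n)) => y B yB.
split=> [n|]; first by apply/SoleckiP; exists (pts B n).
have [i Bi] : exists i, ~ escaping_reals y (B i).
  apply: contrapT => /forallNP yBi; apply: yB; split.
    exact: null_escaping_reals.
  by move=> _ [i _ <-]; apply: contrapT; exact: yBi.
have /existsNP[N /forallNP NP] := Bi.
apply/nearooP; exists (maxn N i.+1) => n; rewrite geq_max => /andP[Nn ni].
have [k kn yk] : exists2 k, (k < n)%N & set_val (y n) (point_bits n k (B i)).
  apply: contrapT => nk; apply: (NP n); split=> // k kn yk.
  by apply: nk; exists k.
have ik : (i * n + k < n * n)%N.
  apply: (@leq_trans (i.+1 * n)); last by rewrite leq_mul2r ni orbT.
  by rewrite mulSn addnC ltn_add2r.
exists (i * n + k)%N; first by rewrite size_mkseq.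
rewrite nth_mkseq// modnMDl modn_small// divnMDl ?divn_small ?addn0//.
exact: leq_ltn_trans kn.
Qed.

End random_points.

(** [G phi] lists the reals of all points in the hitting sets for [phi]. If the null set [A]
    contains them all, each such point is eventually avoided by the sets [Us A n], so a branch
    [Us A (f n)] captured by [phi] has [f n] bounded in terms of its past. *)
Lemma Solecki_sequential :
  exists (G : (seq (set_type (Omega R)) -> set (set_type (Omega R))) -> nat -> R)
    (H : set R -> (nat -> nat) -> nat -> set_type (Omega R))
    (K : (seq (set_type (Omega R)) -> set (set_type (Omega R))) -> set R -> nat -> nat),
  forall A f phi, M_rel (Solecki R) (H A f) phi ->
    null_noncover_rel A (G phi) \/ le_star f (K phi A).
Proof.
have [U0 _] := Omega_avoiding R [::].
have [|en enT] := countable_range (countable_Omega R); first by exists U0.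
have /choice[code codeK] : forall U, exists n, en n = U.
  by move=> U; have [n _ <-] : range en U by [rewrite -enT]; exists n.
have /choice[F FP] : forall A, exists F, Solecki R A -> A `<=` hit_by F.
  move=> A; have [/SoleckiP[F AF]|] := pselect (Solecki R A); first by exists F.
  by exists [::].
have /choice[Us UsP] : forall A : set R, exists U : nat -> set_type (Omega R),
    null_ideal R A -> forall x, A (bits_real R x) ->
      \forall n \near \oo, ~ set_val (U n) x.
  move=> A; have [/null_bits_real[W [W2 WP]]|] := pselect (null_ideal R A); last first.
    by exists (fun=> U0).
  have /choice[U UP] := fun n => half_clopen_avoiding R (W2 n.+1).
  exists U => _ x /WP/nearooP[N NP]; apply/nearooP; exists N => n Nn.
  by apply: UP; apply: NP; exact: leqW.
(* Omega is countable, so its finite sequences are coded by naturals and one sequence of reals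
   serves all initial segments. *)
pose G (phi : seq (set_type (Omega R)) -> set (set_type (Omega R))) j : R :=
  let p := odflt ([::], 0%N) (unpickle j : option (seq nat * nat)) in
  bits_real R (nth point (F (phi (map en p.1))) p.2).
have /choice[K KP] : forall pA : (seq (set_type (Omega R)) ->
      set (set_type (Omega R))) * set R,
    exists k, forall f, M_rel (Solecki R) (Us pA.2 \o f) pA.1 ->
      null_noncover_rel pA.2 (G pA.1) \/ le_star f k.
  move=> [phi A] /=.
  have [nc|/contrapT[nA GA]] := pselect (null_noncover_rel A (G phi)).
    by exists id => f _; left.
  have /choice[g gP] : forall t : seq nat, exists N, forall n, (N <= n)%N ->
      ~ hit_by (F (phi (map (Us A) t))) (Us A n).
    move=> t; set Ft := F _.
    have FtA i : A (bits_real R (nth point Ft i)).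
      have := GA (G phi (pickle (map (code \o Us A) t, i))).
      rewrite /G pickleK /= -map_comp.
      rewrite (eq_map (g := Us A)); last by move=> n /=; rewrite codeK.
      by apply; exists (pickle (map (code \o Us A) t, i)); rewrite // /G pickleK /=
        -map_comp (eq_map (g := Us A))// => n /=; rewrite codeK.
    have /choice[N NP] : forall i, exists N, forall n, (N <= n)%N ->
        ~ set_val (Us A n) (nth point Ft i).
      by move=> i; have /nearooP := UsP _ nA _ (FtA i).
    (* The hitting set is finite, so one level works for all its points. *)
    exists (\max_(i < size Ft) N i) => n Nn [i iF]; apply: NP.
    exact: leq_trans (leq_bigmax (Ordinal iF)) Nn.
  have [k kP] := predicted_bounded g.
  exists k => f [okphi /nearooP[N NP]]; right; apply: kP; apply/nearooP.
  exists N => n /NP; have -> : mkseq (Us A \o f) n = map (Us A) (mkseq f n).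
    by rewrite /mkseq map_comp.
  move=> /(FP _ (okphi _)) hit; rewrite leqNgt; apply/negP => /ltnW/gP; exact.
exists G, (fun A f => Us A \o f), (fun phi A => K (phi, A)) => A f phi.
exact: (KP (phi, A)).
Qed.

Let countableO := countable_Omega R.
Let idS := ideal_Solecki.

Let M_dnum_bnum : bnum (K_rel (Solecki R)) #<= bnum (M_rel (Solecki R)) /\
  dnum (M_rel (Solecki R)) #<= dnum (K_rel (Solecki R)).
Proof.
split; first exact: tukey_bnum (tukey_M_K _) (unbounded_M_rel idS).
exact: tukey_dnum (tukey_M_K _) (serial_K_rel idS).
Qed.

(** With [tukey_M_K] this closes a cycle of inequalities through K, M and the maximum. *)
Lemma Solecki_bnum :
  bnum (M_rel (Solecki R)) #<= maxc bounding (cov_omega_null R) /\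
  maxc bounding (cov_omega_null R) #<= bnum (K_rel (Solecki R)).
Proof.
have [bM cM] := maxc_ub bounding (cov_omega_null R).
split.
  have [G [H [K GHK]]] := Solecki_sequential.
  apply: (sequential_bnum GHK).
  - by apply: infinite_card_le bM _; rewrite boundingE; exact: infinite_bnum_le_star.
  - exact: unbounded_null_noncover.
  - exact: unbounded_le_star.
  - by rewrite (card_le_eql bnum_null_noncover).
  - by rewrite -boundingE.
have uK := unbounded_K_rel idS.
have Kl := tukey_K_le_star idS countableO.
apply: maxc_lub; first by rewrite boundingE; exact: tukey_bnum Kl uK.
rewrite -(card_le_eql bnum_null_noncover).
exact: tukey_bnum tukey_K_null_noncover uK.
Qed.

Lemma Solecki_dnum :
  dnum (K_rel (Solecki R)) #<= minc dominating (non (null_ideal R)) /\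
  minc dominating (non (null_ideal R)) #<= dnum (M_rel (Solecki R)).
Proof.
have [md mn] := minc_lb dominating (non (null_ideal R)).
split.
  have Kl := tukey_K_le_star idS countableO.
  apply: minc_glb; first exact: tukey_dnum Kl serial_le_star.
  rewrite -(card_le_eqr dnum_null_noncover).
  exact: tukey_dnum tukey_K_null_noncover serial_null_noncover.
have [G [H [K GHK]]] := Solecki_sequential.
have [|] := sequential_dnum GHK (serial_M_rel idS).
  rewrite (card_le_eql dnum_null_noncover); exact: card_le_trans.
exact: card_le_trans.
Qed.

Lemma non_Solecki : non (M_ideal (Solecki R)) #= non (K_ideal (Solecki R)) /\
  non (K_ideal (Solecki R)) #= maxc bounding (cov_omega_null R).
Proof.
have [KM _] := M_dnum_bnum; have [MX XK] := Solecki_bnum.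
have eM := non_M_rel idS; have eK := non_K_rel idS.
split; apply: Cantor_Bernstein.
- rewrite (card_le_eql eM) (card_le_eqr eK); exact: card_le_trans XK.
- by rewrite (card_le_eql eK) (card_le_eqr eM).
- rewrite (card_le_eql eK); exact: card_le_trans MX.
- by rewrite (card_le_eqr eK).
Qed.

Lemma cov_Solecki : cov (M_ideal (Solecki R)) #= cov (K_ideal (Solecki R)) /\
  cov (K_ideal (Solecki R)) #= minc dominating (non (null_ideal R)).
Proof.
have [_ MK] := M_dnum_bnum; have [KX XM] := Solecki_dnum.
have eM := cov_M_rel idS; have eK := cov_K_rel idS.
split; apply: Cantor_Bernstein.
- by rewrite (card_le_eql eM) (card_le_eqr eK).
- rewrite (card_le_eql eK) (card_le_eqr eM); exact: card_le_trans XM.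
- by rewrite (card_le_eql eK).
- rewrite (card_le_eqr eK); exact: card_le_trans MK.
Qed.

End Solecki_cardinals.

(** * The density zero ideal *)

Section density.

Definition density_count (A : set nat) (n : nat) : nat := \sum_(0 <= k < n) (k \in A).

Lemma density_count_card A n :
  density_count A n = #|[pred k : 'I_n | (k : nat) \in A]|.
Proof.
rewrite /density_count big_mkord -sum1_card [RHS]big_mkcond/=.
by apply: eq_bigr => k _; rewrite inE; case: (_ \in A).
Qed.

Lemma leq_density_count A n m : (n <= m)%N -> (density_count A n <= density_count A m)%N.
Proof.
by move=> nm; rewrite /density_count (big_cat_nat (leq0n n) nm)/= leq_addr.
Qed.

Lemma density_countS A B n : A `<=` B -> (density_count A n <= density_count B n)%N.
Proof.
move=> AB; apply: leq_sum => k _; case: (boolP (k \in A)) => //.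
by rewrite inE => /AB/mem_set ->.
Qed.

Lemma density_countU A B n :
  (density_count (A `|` B) n <= density_count A n + density_count B n)%N.
Proof.
rewrite /density_count -big_split/=; apply: leq_sum => k _.
by rewrite in_setU; case: (_ \in A); case: (_ \in B).
Qed.

Lemma density_countT n : density_count setT n = n.
Proof.
rewrite /density_count (eq_bigr (fun=> 1%N)); last by move=> k _; rewrite in_setT.
by rewrite sum_nat_const_nat muln1 subn0.
Qed.

Lemma density_count_bounded A N n : (forall k, A k -> (k <= N)%N) ->
  (density_count A n <= N.+1)%N.
Proof.
move=> AN; rewrite -[leqRHS](density_countT N.+1) /density_count.
have [nN|Nn] := leqP n N.+1.
  apply: leq_trans (leq_density_count _ nN); apply: leq_sum => k _.
  by rewrite in_setT leq_b1.
rewrite (big_cat_nat (leq0n N.+1) (ltnW Nn))/=.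
rewrite [X in (_ + X)%N]big1_seq ?addn0.
  by apply: leq_sum => k _; rewrite in_setT leq_b1.
move=> k /andP[_]; rewrite mem_index_iota => /andP[Nk _].
by apply/eqP; rewrite eqb0; apply/negP; rewrite inE => /AN; rewrite leqNgt Nk.
Qed.

(** Multipliers [p] replace 1/epsilon, which keeps the counting in the naturals. *)
Lemma density_zeroP (R : realType) A : density_zero R A <->
  forall p, \forall n \near \oo, (p * density_count A n <= n)%N.
Proof.
pose r n : R := (density_count A n)%:R / n%:R.
have -> : density_zero R A = (r n @[n --> \oo] --> (0 : R)).
  by rewrite /r; under [in RHS]eq_fun do rewrite density_count_card.
have r0 n : 0 <= r n by rewrite divr_ge0.
split=> [/cvgrPdist_lt r_cvg p|dA].
  have p0 : 0 < (p.+1%:R : R)^-1 by rewrite invr_gt0.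
  have /nearooP[N NP] := r_cvg _ p0; apply/nearooP; exists N.+1 => -[//|n] Nn.
  have := NP n.+1 (ltnW Nn); rewrite sub0r normrN ger0_norm// /r.
  rewrite ltr_pdivrMr ?ltr0n// mulrC ltr_pdivlMr ?ltr0n// -natrM ltr_nat => h.
  by apply: ltnW; apply: leq_ltn_trans h; rewrite mulnC leq_mul2l leqnSn orbT.
apply/cvgrPdist_lt => e e0; have [M Me] := half_exp_lt e0.
have /nearooP[N NP] := dA (2 ^ M)%N; apply/nearooP; exists N.+1 => -[//|n] Nn.
rewrite sub0r normrN ger0_norm//; apply: le_lt_trans Me.
rewrite /r ler_pdivrMr ?ltr0n// exprVn mulrC ler_pdivlMr ?exprn_gt0//.
by rewrite -natrX -natrM ler_nat mulnC; apply: NP; exact: ltnW.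
Qed.

Lemma ideal_density_zero (R : realType) : ideal (density_zero R).
Proof.
split.
- move=> A /finite_nat_bound[N AN]; apply/density_zeroP => p; apply/nearooP.
  exists (p * N.+1)%N => n; apply: leq_trans.
  by rewrite leq_mul2l density_count_bounded ?orbT.
- move=> /density_zeroP/(_ 2%N)/nearooP[N /(_ N.+1 (leqnSn _))].
  by rewrite density_countT; lia.
- move=> A B AB /density_zeroP dB; apply/density_zeroP => p.
  apply: filterS (dB p) => n; apply: leq_trans.
  by rewrite leq_mul2l density_countS ?orbT.
- move=> A B /density_zeroP dA /density_zeroP dB; apply/density_zeroP => p.
  apply: filterS2 (dA (2 * p)%N) (dB (2 * p)%N) => n.
  by have := density_countU A B n; nia.
Qed.

End density.

(** * Binary words and their codes *)

Section binary_words.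

Definition words n : seq (seq bool) := [seq val t | t <- enum {: n.-tuple bool}].

Lemma mem_words n s : (s \in words n) = (size s == n).
Proof.
apply/mapP/eqP => [[t _ ->]|sn]; first exact: size_tuple.
have sn' : size s == n by apply/eqP.
by exists (Tuple sn'); rewrite ?mem_enum.
Qed.

Lemma uniq_words n : uniq (words n).
Proof. by rewrite map_inj_uniq ?enum_uniq//; exact: val_inj. Qed.

Lemma size_words n : size (words n) = (2 ^ n)%N.
Proof. by rewrite size_map -cardE card_tuple card_bool. Qed.

Lemma count_words_card n (P : pred (seq bool)) :
  count P (words n) = #|finset (fun t : n.-tuple bool => P t)|.
Proof.
rewrite /words count_map cardsE cardE size_filter.
by rewrite -[RHS](count_map val) -/(words n) count_map enumT.
Qed.

(** The number whose binary expansion is 1 followed by [s]. *)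
Definition code (s : seq bool) : nat := (2 ^ size s + bval s)%N.

Lemma code_inj : injective code.
Proof.
have szle s t : code s = code t -> (size s <= size t)%N.
  move=> st; rewrite leqNgt; apply/negP => lt.
  have := ltn_bval t; rewrite -(ltn_add2l (2 ^ size t)) -/(code t) -st.
  rewrite addnn -mul2n -expnS.
  by rewrite ltnNge => /negP; apply; apply: leq_trans (leq_addr _ _); rewrite leq_exp2l.
move=> s t st; have sz : size s = size t by apply/eqP; rewrite eqn_leq !szle.
by move: st; rewrite /code sz => /addnI; exact: bval_inj.
Qed.

Lemma density_count_double (A : set nat) n : density_count A (2 ^ n.+1) =
  (density_count A (2 ^ n) + count (fun s => code s \in A) (words n))%N.
Proof.
have n2 : (2 ^ n <= 2 ^ n.+1)%N by rewrite leq_exp2l.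
rewrite /density_count (big_cat_nat (leq0n _) n2)/=; congr addn.
rewrite -[X in \sum_(X <= _ < _) _]add0n big_addn expnS mul2n -addnn addnK big_mkord.
pose h (t : n.-tuple bool) : 'I_(2 ^ n) :=
  Ordinal (leq_trans (ltn_bval t) (leq_pexp2l (isT : (0 < 2)%N)
    (eq_leq (size_tuple t)))).
have hbij : bijective h.
  apply: inj_card_bij; last by rewrite card_ord card_tuple card_bool.
  move=> t u /(congr1 val)/= tu; apply: val_inj; apply: bval_inj => //.
  by rewrite !size_tuple.
rewrite (reindex h (onW_bij _ hbij))/= /words count_map -sum1_count [RHS]big_mkcond.
rewrite big_enum/=; apply: eq_bigr => t _.
by rewrite /code size_tuple addnC; case: (_ \in A).
Qed.

End binary_words.

(** * From closed null sets to density zero sets *)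

Section density_zero_cardinals.
Variable R : realType.

Let idZ := ideal_density_zero R.

Let E_rel := mem_rel (E_ideal R).

(** By compactness, from some level on, every word met by [C] extends a word of a cover of weight
    below 1/(q+1). *)
Lemma closed_null_level_count (C : set cantor_space) q :
  closed C -> cantor_measure R C = 0%E ->
  \forall n \near \oo,
    (q * count (fun s => `[< exists2 x, C x & mkseq x (size s) = s >]) (words n)
     <= 2 ^ n)%N.
Proof.
move=> cC C0.
have : (cantor_measure R C < (q.+1%:R^-1 : R)%:E)%E.
  by rewrite C0 lte_fin invr_gt0 ltr0n.
move=> /ereal_inf_lt[_ [c Cc <-] cq].
(* A point outside [C] satisfies [P] vacuously once its cylinder misses [C], so every point reaches
   some level. *)
pose P n (x : cantor_space) :=
  (exists2 y, C y & mkseq y n = mkseq x n) ->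
  exists2 j, (size (c j) <= n)%N & mkseq x (size (c j)) = c j.
have take_eq m n (x y : cantor_space) : (n <= m)%N ->
    mkseq x m = mkseq y m -> mkseq x n = mkseq y n.
  by move=> nm /(congr1 (take n)); rewrite !take_mkseq.
have [||x|n0 nP] := @cantor_uniform_level P.
- move=> n x y xy Px [z Cz zy]; have [|j jn xj] := Px; first by exists z; rewrite ?xy.
  by exists j => //; rewrite -[RHS]xj; apply: take_eq jn _.
- move=> n m x nm Px [y Cy yx]; have [|j jn xj] := Px.
    by exists y => //; exact: take_eq yx.
  by exists j => //; exact: leq_trans nm.
- have [Cx|nCx] := pselect (C x).
    by have [j _ xj] := Cc _ Cx; exists (size (c j)) => _; exists j.
  have [n nC] := open_cylinder (closed_openC cC) nCx.
  by exists n => -[y Cy yx]; have := nC _ yx.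
apply/nearooP; exists n0 => n n0n; rewrite count_words_card; set S := finset _.
have : ((#|S|%:R * 2^-1 ^+ n)%:E < (q.+1%:R^-1 : R)%:E)%E.
  apply: le_lt_trans cq.
  apply: (@le_trans _ _ (cantor_measure R (\bigcup_j cylinder (c j)))).
    apply: card_le_cantor_measure => x t; rewrite inE => /asboolP[y Cy].
    rewrite size_tuple => yt xt; have [|j _ xj] := nP x.
      by exists y => //; apply: take_eq n0n _; rewrite yt xt.
    by exists j.
  by apply: ereal_inf_lbound; exists c.
rewrite lte_fin exprVn ltr_pdivrMr ?exprn_gt0// mulrC ltr_pdivlMr ?ltr0n//.
rewrite -natrX -natrM ltr_nat => h; apply: ltnW; apply: leq_ltn_trans h.
by rewrite mulnC leq_mul2l leqnSn orbT.
Qed.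

(** The codes of length [n] fill [2^n, 2^(n+1)), so the count up to a power of two is a geometric
    sum of the level counts. *)
Lemma density_zero_tree (T : seq bool -> Prop) (dec : nat -> seq bool) :
  (forall s, dec (code s) = s) ->
  (forall q, \forall n \near \oo,
    (q * count (fun s => `[< T s >]) (words n) <= 2 ^ n)%N) ->
  density_zero R [set k | T (dec k)].
Proof.
move=> decK Tn; apply/density_zeroP => p; set A := [set k | _].
(* One factor 2 pays for rounding up to a power of two, the other leaves room for the levels below
   [J]. *)
have /nearooP[J JP] := Tn (4 * p)%N.
have cA n : count (fun s => code s \in A) (words n) =
    count (fun s => `[< T s >]) (words n).
  by apply: eq_count => s /=; apply/idP/asboolP; rewrite inE /A /= decK.
have AL k : (4 * p * density_count A (2 ^ (J + k)) <=
    4 * p * 2 ^ J + 2 ^ (J + k))%N.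
  elim: k => [|k IH].
    rewrite addn0; apply: leq_trans (leq_addr _ _); rewrite leq_mul2l.
    by rewrite -[X in (_ <= X)%N]density_countT density_countS ?orbT.
  rewrite addnS density_count_double cA mulnDr expnS.
  by have := JP (J + k)%N (leq_addr _ _); lia.
(* The first summand absorbs the levels below [J]; the second ensures that [n] is at least 2^J even
   for [p = 0]. *)
apply/nearooP; exists (4 * p * 2 ^ J + 2 ^ J)%N => n Jn.
have n0 : (0 < n)%N by apply: leq_trans Jn; rewrite addn_gt0 expn_gt0 orbT.
have /andP[Ln nL] := trunc_log_bounds (isT : (1 < 2)%N) n0.
set L := trunc_log 2 n in Ln nL.
have JL : (J <= L.+1)%N.
  rewrite -(@leq_exp2l 2)//; apply: leq_trans (ltnW nL).
  by apply: leq_trans Jn; exact: leq_addl.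
have := AL (L.+1 - J)%N; rewrite subnKC// expnS => h.
have h2 : (4 * p * density_count A n <= 4 * p * density_count A (2 ^ L.+1))%N.
  by rewrite leq_mul2l leq_density_count ?orbT// ltnW.
by move: h2; rewrite expnS; move: h Jn Ln; lia.
Qed.

Lemma decoderP : exists dec : nat -> seq bool, forall s, dec (code s) = s.
Proof.
have /choice[dec decP] : forall k, exists s, forall t, code t = k -> s = t.
  move=> k; have [[s sk]|nk] := pselect (exists s, code s = k).
    by exists s => t tk; apply: code_inj; rewrite sk tk.
  by exists [::] => t tk; exfalso; apply: nk; exists t.
by exists dec => s; exact: decP.
Qed.

(* [y] is mapped to the concatenation of the words coded by its values; the padding
   bit makes it infinite even when these words are empty. *)
Lemma tukey_M_E : tukey (M_rel (density_zero R)) E_rel.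
Proof.
have [dec decK] := decoderP.
pose fl (s : seq nat) := flatten [seq rcons (dec k) false | k <- s].
have fl_rcons s k : fl (rcons s k) = fl s ++ rcons (dec k) false.
  by rewrite /fl map_rcons flatten_rcons.
have size_fl s : (size s <= size (fl s))%N.
  elim/last_ind: s => // s k IH; rewrite fl_rcons size_cat !size_rcons.
  by rewrite addnS ltnS; exact: leq_trans (leq_addr _ _).
(* Each word contributes at least its padding bit, so [i + 1] words suffice to read bit [i]. *)
pose h (y : nat -> nat) : cantor_space := fun i => nth false (fl (mkseq y i.+1)) i.
have nth_fl y n m i : (n <= m)%N -> (i < size (fl (mkseq y n)))%N ->
    nth false (fl (mkseq y m)) i = nth false (fl (mkseq y n)) i.
  move=> nm iN; have [u ->] : exists u, fl (mkseq y m) = fl (mkseq y n) ++ u.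
    rewrite -(subnKC nm); elim: (m - n)%N => [|k [u IH]].
      by exists [::]; rewrite addn0 cats0.
    rewrite addnS mkseqS fl_rcons IH -catA.
    by exists (u ++ rcons (dec (y (n + k)%N)) false).
  by rewrite nth_cat iN.
have mkh y n : mkseq (h y) (size (fl (mkseq y n))) = fl (mkseq y n).
  apply: (@eq_from_nth _ false); rewrite size_mkseq// => i iN.
  rewrite nth_mkseq// /h; have [ni|/ltnW ni] := leqP n i.+1; first exact: nth_fl.
  apply/esym; apply: nth_fl => //.
  by apply: leq_trans (size_fl _); rewrite size_mkseq.
have hE A : E_ideal R A -> exists2 phi, (forall s, density_zero R (phi s)) &
    forall y, A (h y) -> M_gen phi y.
  have [M0 Msub Mcup] : sigma_ideal (M_ideal (density_zero R)).
    exact: sigma_ideal_smallest.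
  (* The sets whose preimage under [h] is in the M-ideal form a sigma-ideal, so only closed null
     sets need to be treated. *)
  suff EM : E_ideal R `<=` [set A | M_ideal (density_zero R) (h @^-1` A)].
    by move=> /EM; rewrite /= (M_idealE idZ).
  apply: smallest_sub.
    split => //.
    - by move=> B D BD; apply: Msub => y; exact: BD.
    - by move=> B MB; rewrite /= preimage_bigcup; exact: Mcup.
  move=> C [cC C0]; rewrite /= (M_idealE idZ).
  pose T s := exists2 x, C x & mkseq x (size s) = s.
  exists (fun s => [set k | T (fl s ++ dec k)]).
    move=> s; apply: (@density_zero_tree (fun t => T (fl s ++ t))) => // q.
    (* The factor 2^[size (fl s)] makes the count small relative to the extensions of the stem
       [fl s]. *)
    have /nearooP[N NP] := @closed_null_level_count C (q * 2 ^ size (fl s)) cC C0.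
    apply/nearooP; exists N => n Nn.
    have := NP (size (fl s) + n)%N (leq_trans Nn (leq_addl _ _)).
    rewrite expnD -mulnA mulnCA leq_pmul2l ?expn_gt0//; apply: leq_trans.
    rewrite leq_mul2l -!size_filter; apply/orP; right.
    rewrite -(size_map (cat (fl s))); apply: uniq_leq_size.
      rewrite map_inj_uniq ?filter_uniq ?uniq_words// => t u /eqP.
      by rewrite eqseq_cat// eqxx => /eqP.
    move=> _ /mapP[t + ->]; rewrite !mem_filter !mem_words => /andP[Tt /eqP tn].
    by apply/andP; split; [exact: Tt|rewrite size_cat tn].
  move=> y Cy; apply/nearooP; exists 0%N => n _; exists (h y) => //.
  have := mkh y n.+1; rewrite mkseqS fl_rcons -cats1 catA.
  (* [X] ends with the word coded by [y n], before its padding bit. *)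
  set X := _ ++ dec _ => /(congr1 (take (size X))).
  by rewrite take_size_cat// take_mkseq// size_cat leq_addr.
have /choice[v vP] : forall A, exists phi, E_ideal R A ->
    (forall s, density_zero R (phi s)) /\ forall y, A (h y) -> M_gen phi y.
  move=> A; have [/hE[phi okphi Aphi]|] := pselect (E_ideal R A); first by exists phi.
  by exists (fun=> set0).
by exists h, v => y A [/vP[okv vA] /vA].
Qed.

End density_zero_cardinals.

(** * Cutting a binary sequence into blocks *)

Section block_codes.

Definition block_start (f : nat -> nat) n := sumn (mkseq f n).

Definition block_codes (f : nat -> nat) (x : nat -> bool) (n : nat) : nat :=
  code (mkseq (fun i => x (block_start f n + i)%N) (f n)).

Lemma block_startS f n : block_start f n.+1 = (block_start f n + f n)%N.
Proof. by rewrite /block_start mkseqS sumn_rcons. Qed.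

Lemma mkseqD (T : Type) (x : nat -> T) n m :
  mkseq x (n + m) = mkseq x n ++ mkseq (fun i => x (n + i)%N) m.
Proof.
by rewrite /mkseq iotaD map_cat add0n -[X in iota X m]addn0 iotaDl -map_comp.
Qed.

Lemma mkseq_block_codes f x n : mkseq (block_codes f x) n =
  map code (reshape (mkseq f n) (mkseq x (block_start f n))).
Proof.
elim: n => // n IH; rewrite [LHS]mkseqS IH block_startS mkseqD mkseqS.
rewrite reshape_rcons; last by rewrite size_cat !size_mkseq.
by rewrite map_rcons take_size_cat ?size_mkseq// drop_size_cat ?size_mkseq.
Qed.

End block_codes.

(** * Closed null sets from block conditions *)

Section block_null.
Variable R : realType.
Variables (phi : seq nat -> set nat) (f : nat -> nat) (n0 : nat).

Let ok n (s w : seq bool) : bool :=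
  (n0 <= n)%N ==> `[< phi (map code (reshape (mkseq f n) s)) (code w) >].

(** The words made of the first [n] blocks that obey [phi] from block [n0] on, as a list, so that
    its size gives the weight of a cover of [C]. *)
Let fix_tree := fix T n : seq (seq bool) := if n isn't m.+1 then [:: [::]] else
  flatten [seq [seq s ++ w | w <- words (f m) & ok m s w] | s <- T m].

Let C : set cantor_space := [set x | forall n, (n0 <= n)%N ->
  phi (mkseq (block_codes f x) n) (block_codes f x n)].

Let size_tree n s : s \in fix_tree n -> size s = block_start f n.
Proof.
elim: n s => [|n IH] s /=; first by rewrite inE => /eqP->.
move=> /flattenP[_ /mapP[t /IH tn ->] /mapP[w]].
rewrite mem_filter mem_words => /andP[_ /eqP wn] ->.
by rewrite size_cat tn wn block_startS.
Qed.

Let tree_mem x n : C x -> mkseq x (block_start f n) \in fix_tree n.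
Proof.
move=> Cx; elim: n => [|n IH]; first by rewrite inE.
rewrite block_startS mkseqD /=; apply/flattenP.
exists [seq mkseq x (block_start f n) ++ w |
  w <- words (f n) & ok n (mkseq x (block_start f n)) w].
  exact: map_f IH.
apply: map_f; rewrite mem_filter mem_words size_mkseq eqxx andbT.
by apply/implyP => nn; apply/asboolP; rewrite -mkseq_block_codes; exact: Cx.
Qed.

Let tree_step n c B : (forall s, size s = block_start f n ->
    (c * count (ok n s) (words (f n)) <= B)%N) ->
  (c * size (fix_tree n.+1) <= size (fix_tree n) * B)%N.
Proof.
move=> cB /=; have : forall s, s \in fix_tree n -> size s = block_start f n.
  by move=> s; exact: size_tree.
elim: (fix_tree n) => [|s T IH] sT /=; first by rewrite muln0.
rewrite size_cat size_map size_filter mulnDr mulSn leq_add//.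
  by apply: cB; apply: sT; exact: mem_head.
by apply: IH => t tT; apply: sT; rewrite inE tT orbT.
Qed.

Hypothesis good : forall N, exists n, [/\ (N <= n)%N, (n0 <= n)%N &
  forall s, size s = block_start f n ->
    (2 * count (fun w => `[< phi (map code (reshape (mkseq f n) s)) (code w) >])
             (words (f n)) <= 2 ^ f n)%N].

(** The proportion of words in the tree never grows from block to block and is at least halved at
    each of the infinitely many good blocks. *)
Let tree_small k : exists n, (2 ^ k * size (fix_tree n) <= 2 ^ block_start f n)%N.
Proof.
have up j n : (2 ^ j * size (fix_tree n) <= 2 ^ block_start f n)%N ->
    (2 ^ j * size (fix_tree n.+1) <= 2 ^ block_start f n.+1)%N.
  move=> h; have := @tree_step n 1 (2 ^ f n)%N; rewrite mul1n => step.
  rewrite block_startS expnD; apply: leq_trans (leq_mul h (leqnn _)).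
  rewrite -mulnA leq_mul2l step ?orbT// => s _.
  by rewrite mul1n -size_words count_size.
elim: k => [|k [n IH]]; first by exists 0%N.
have [m [nm n0m mgood]] := good n.
have {}IH : (2 ^ k * size (fix_tree m) <= 2 ^ block_start f m)%N.
  by rewrite -(subnKC nm); elim: (m - n)%N => [|i ?]; rewrite ?addn0// addnS; exact: up.
exists m.+1; have step := @tree_step m 2 (2 ^ f m)%N.
rewrite block_startS expnD expnSr -mulnA; apply: leq_trans (leq_mul IH (leqnn _)).
rewrite -mulnA leq_mul2l step ?orbT// => s /mgood; apply: leq_trans.
rewrite leq_mul2l; apply/orP; right; apply: sub_count => w.
by rewrite /ok n0m.
Qed.

Let closed_C : closed C.
Proof.
have -> : C = \bigcap_n [set x | (n0 <= n)%N ->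
    phi (mkseq (block_codes f x) n) (block_codes f x n)].
  by apply/seteqP; split=> [x Cx n _|x Cx n]; [exact: Cx|exact: Cx].
apply: closed_bigI => n _.
pose Q (s : seq bool) := let D := map code (reshape (mkseq f n.+1) s) in
  (n0 <= n)%N -> phi (take n D) (nth 0%N D n).
have [_] := clopen_level (block_start f n.+1) Q; congr closed.
apply/funext => x; rewrite /mkset /Q -mkseq_block_codes.
by rewrite take_mkseq// nth_mkseq.
Qed.

Lemma block_code_null : E_ideal R C.
Proof.
apply: (@sub_gen_smallest _ (@sigma_ideal cantor_space)); split; first exact: closed_C.
apply/eqP; rewrite eq_le cantor_measure_ge0 andbT.
apply/lee_addgt0Pr => e e0; rewrite add0e; have [k ke] := half_exp_lt e0.
have [n nk] := tree_small k.
apply: le_trans (@cantor_measure_le R (fix_tree n) _ _) _.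
  move=> x /(tree_mem n) xT; exists (mkseq x (block_start f n)) => //.
  by rewrite size_mkseq.
rewrite lee_fin; apply: le_trans (ltW ke).
rewrite (eq_big_seq (fun=> 2^-1 ^+ block_start f n)); last first.
  by move=> s /size_tree ->.
rewrite big_const_seq count_predT iter_addr_0 -[_ *+ size _]mulr_natr !exprVn.
rewrite mulrC ler_pdivrMr ?exprn_gt0// mulrC ler_pdivlMr ?exprn_gt0//.
by rewrite -!natrX -natrM ler_nat mulnC.
Qed.

End block_null.

(** * Invariants of the density zero ideal *)

Section density_zero_theorem.
Variable R : realType.

Let idZ := ideal_density_zero R.
Let E_rel := mem_rel (E_ideal R).
Let sigmaE : sigma_ideal (E_ideal R) := sigma_ideal_smallest _.

(** Multiplier 4 at 2^(n+1) leaves at most half of the 2^n codes of length [n]. *)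
Lemma density_zero_half (A : set nat) : density_zero R A ->
  exists L, forall n, (L <= n)%N ->
    (2 * count (fun w => `[< A (code w) >]) (words n) <= 2 ^ n)%N.
Proof.
move=> /density_zeroP/(_ 4%N)/nearooP[N NP]; exists N => n Nn.
have -> : count (fun w => `[< A (code w) >]) (words n) =
    count (fun s => code s \in A) (words n).
  by apply: eq_count => s /=; apply/asboolP/idP; rewrite inE.
have := NP (2 ^ n.+1)%N; rewrite density_count_double expnS.
have n2 : (n < 2 ^ n)%N by rewrite ltn_expl.
by move=> /(_ (leq_trans Nn (leq_trans (ltnW n2) (@leq_pmull (2 ^ n) 2 isT)))); lia.
Qed.

(** [f] gives block lengths. If it is not dominated, infinitely many blocks are so long that [phi]
    allows at most half of the words there, whatever the earlier blocks, and the captured [x] form a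
    set in [E_ideal]. *)
Lemma density_zero_sequential :
  exists (G : (seq nat -> set nat) -> nat -> nat)
    (K : (seq nat -> set nat) -> (nat -> nat) -> set cantor_space),
  forall f x phi, M_rel (density_zero R) (block_codes f x) phi ->
    le_star f (G phi) \/ E_rel x (K phi f).
Proof.
have /choice[G GP] : forall phi : seq nat -> set nat, exists k,
    (forall s, density_zero R (phi s)) -> forall f, ~ le_star f k ->
    E_ideal R [set x | M_gen phi (block_codes f x)].
  move=> phi; have [okphi|] := pselect (forall s, density_zero R (phi s)); last first.
    by exists id.
  have /choice[l lP] := fun s => density_zero_half (okphi s).
  (* [sumn t] is the total length of the earlier blocks; only finitely many words [s] have that
     length, so one bound serves them all. *)
  pose g (t : seq nat) := \max_(s <- words (sumn t)) l (map code (reshape t s)).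
  have [k kP] := predicted_bounded g; exists k => _ f /(contra_not (kP f)) fg.
  have [E0 Esub Ecup] := sigmaE.
  (* Splitting by the block [n0] from which [phi] captures gives countably many closed null sets. *)
  apply: Esub (Ecup (fun n0 => [set x | forall n, (n0 <= n)%N ->
    phi (mkseq (block_codes f x) n) (block_codes f x n)]) _).
    by move=> x /nearooP[n0 xn0]; exists n0.
  move=> n0; apply: block_code_null => N.
  have [n] := not_nearoo fg (maxn N n0); rewrite geq_max => /andP[Nn n0n].
  move=> /negP; rewrite -ltnNge => gf; exists n; split=> // s sn.
  apply: lP; apply: leq_trans (ltnW gf); apply: (leq_bigmax_seq _) => //.
  by rewrite mem_words sn.
exists G, (fun phi f => [set x | M_gen phi (block_codes f x)]) => f x phi [okphi xphi].
have [fG|nfG] := pselect (le_star f (G phi)); first by left.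
by right; split=> //; exact: GP.
Qed.

Let serial_E : serial_rel E_rel.
Proof.
move=> x; exists [set x]; split=> //.
apply: (@sub_gen_smallest _ (@sigma_ideal cantor_space)); split.
  exact/accessible_closed_set1/hausdorff_accessible/cantor_space_hausdorff.
apply/eqP; rewrite eq_le cantor_measure_ge0 andbT.
apply/lee_addgt0Pr => e e0; rewrite add0e; have [k ke] := half_exp_lt e0.
apply: le_trans (@cantor_measure_le R [:: mkseq x k] _ _) _.
  by move=> _ ->; exists (mkseq x k); rewrite ?inE// size_mkseq.
by rewrite big_seq1 size_mkseq lee_fin ltW.
Qed.

Let tukey_M_le_star : tukey (M_rel (density_zero R)) le_star.
Proof.
apply: tukey_trans (tukey_M_K _) _; apply: tukey_K_le_star => //; exact: countableP.
Qed.

Let uM := unbounded_M_rel idZ.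

Lemma non_M_density_zero :
  non (M_ideal (density_zero R)) #= maxc bounding (non (E_ideal R)).
Proof.
apply: card_eq_trans (non_M_rel idZ) _.
have [bM eM] := maxc_ub bounding (non (E_ideal R)).
have uE : unbounded_rel E_rel := tukey_unbounded (tukey_M_E R) uM.
rewrite (non_mem_rel sigmaE) boundingE in bM eM *.
apply: Cantor_Bernstein; last first.
  by apply: maxc_lub; apply: tukey_bnum => //; exact: tukey_M_E.
have [G [K GK]] := density_zero_sequential.
apply: (sequential_bnum GK) => //; last exact: unbounded_le_star.
exact: infinite_card_le bM infinite_bnum_le_star.
Qed.

Lemma cov_M_density_zero :
  cov (M_ideal (density_zero R)) #= minc dominating (cov (E_ideal R)).
Proof.
apply: card_eq_trans (cov_M_rel idZ) _.
have [md me] := minc_lb dominating (cov (E_ideal R)).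
have cE := cov_mem_rel serial_E.
apply: Cantor_Bernstein.
  apply: minc_glb; first exact: tukey_dnum tukey_M_le_star serial_le_star.
  by rewrite (card_le_eqr cE); exact: tukey_dnum (tukey_M_E R) serial_E.
have [G [K GK]] := density_zero_sequential.
have [dM|eM] := sequential_dnum GK (serial_M_rel idZ).
  exact: card_le_trans md dM.
by apply: card_le_trans me _; rewrite (card_le_eql cE).
Qed.

End density_zero_theorem.

Theorem theoremB (R : realType) :
  [/\ (non (M_ideal FinFin) #= e_const_le 2
       /\ cov (M_ideal FinFin) #= v_const_le 2)
      /\ (non (K_ideal FinFin) #= bounding
          /\ cov (K_ideal FinFin) #= dominating),
      (non (M_ideal (Solecki R)) #= non (K_ideal (Solecki R))
       /\ non (K_ideal (Solecki R)) #= maxc bounding (cov_omega_null R))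
      /\ (cov (M_ideal (Solecki R)) #= cov (K_ideal (Solecki R))
          /\ cov (K_ideal (Solecki R)) #= minc dominating (non (null_ideal R)))
    & non (M_ideal (density_zero R)) #= maxc bounding (non (E_ideal R))
      /\ cov (M_ideal (density_zero R)) #= minc dominating (cov (E_ideal R))].
Proof.
split.
- split; split.
  + exact: non_M_FinFin.
  + exact: cov_M_FinFin.
  + exact: non_K_FinFin.
  + exact: cov_K_FinFin.
- split; [exact: non_Solecki|exact: cov_Solecki].
- split; [exact: non_M_density_zero|exact: cov_M_density_zero].
Qed.
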